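(* Let $J\subset\mathbb R$ be a compact interval with nonempty interior and $\varepsilon>0$. The CH23 singleton-window spectral/pseudospectral ambient $$\mathcal U^\sharp_{2,J,\varepsilon}=\{\mathcal P^\sigma_{J,\mathrm{diag}},\mathcal P^\sigma_{J,\mathrm{gen}},\mathcal P^\sigma_{J,\mathrm{graph}},\mathcal P^{\sigma_\varepsilon}_{J,\varepsilon,\mathrm{diag}},\mathcal P^{\sigma_\varepsilon}_{J,\varepsilon,\mathrm{gen}},\mathcal P^{\sigma_\varepsilon}_{J,\varepsilon,\mathrm{graph}}\}$$ satisfies $$\bigl|\operatorname{MinDeg}^{\mathrm{raw}}_2(\mathcal U^\sharp_{2,J,\varepsilon})\bigr|=1,\qquad\text{but}\qquad\bigl|\operatorname{MinDeg}^{\mathrm{geom}}_2(\mathcal U^\sharp_{2,J,\varepsilon})\bigr|=2,$$ where $\mathrm{geom}$ denotes the CH23 $(J,\varepsilon)$-geometric modality. Thus it is raw-principal but geometrically non-principal.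
   Context: $\mathbb N=\{1,2,\dots\}$, $\mathbb N_0=\{0,1,2,\dots\}$. SCI height. For an SCI problem $\mathcal P=(\Xi,\Omega,(\mathcal M,d),\Lambda)$ (instance set $\Omega$, metric space $\mathcal M$, target $\Xi:\Omega\to\mathcal M$, $\Lambda$ a set of complex-valued functions on $\Omega$ separating instances with distinct target values), a general algorithm is a pair $(\Gamma,\Lambda_\Gamma)$, $\Gamma:\Omega\to\mathcal M$, $\Lambda_\Gamma(A)\subseteq\Lambda$ finite, such that if $f(B)=f(A)$ for all $f\in\Lambda_\Gamma(A)$ then $\Gamma(B)=\Gamma(A)$ and $\Lambda_\Gamma(B)=\Lambda_\Gamma(A)$. A height-$0$ tower is a general algorithm with $\Gamma=\Xi$; a height-$k$ tower ($k\ge1$) is a family of general algorithms with $\Xi(A)=\lim_{n_k\to\infty}\cdots\lim_{n_1\to\infty}\Gamma_{n_k,\dots,n_1}(A)$ for all $A$. $\operatorname{SCI}_{\mathrm G}(\mathcal P)$ is the least height of a tower ($\infty$ if none). Windows. $\mathcal K_{\mathrm{sgl}}(J)=\{\{z\}:z\in J\}$; for each $K=\{z\}$ fix $r_n(K)\in\mathbb Q+i\mathbb Q$ with $|r_n(K)-z|\le2^{-(n+1)}$, $n\in\mathbb N$. Operator instance classes, with Hilbert spaces $H_{\mathrm{diag}}=H_{\mathrm{gen}}=\ell^2(\mathbb N)$, $H_{\mathrm{graph}}=\ell^2(V)$, where $V=\{v_1,v_2,\dots\}$ is the vertex set of a fixed connected countable graph. (diag) $\Omega_{\mathrm{diag}}$: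 maximal diagonal operators, $Ae_j=a_je_j$ with $(a_j)\subset\mathbb C$ arbitrary, $\mathcal D(A)=\{x:(a_jx_j)_j\in\ell^2(\mathbb N)\}$. (gen) $\Omega_{\mathrm{gen}}$: closed densely defined operators $A$ on $\ell^2(\mathbb N)$ for which $\operatorname{span}\{e_n\}$ is a core of $A$ and $A^*$, together with $f:\mathbb N\to\mathbb N$ and a null sequence $(c_n)$ of nonnegative rationals with $\max\{\|(I-P_{f(n)})AP_n\|,\|(I-P_{f(n)})A^*P_n\|\}\le c_n$, $P_n$ the orthogonal projection onto $\operatorname{span}\{e_1,\dots,e_n\}$. (graph) $\Omega_{\mathrm{graph}}$: closed densely defined operators $A$ on $\ell^2(V)$ for which $\operatorname{span}\{\mathbf 1_v\}$ is a core of $A$ and $A^*$, with $\alpha_A(v,w)=\langle A\mathbf 1_w,\mathbf 1_v\rangle$, together with finite sets $S_v\subset V$ such that $\alpha_A(v,w)=\alpha_A(w,v)=0$ for $w\notin S_v$. $\operatorname{op}_\rho:\Omega_\rho\to\mathcal C(H_\rho)$ sends an instance to its underlying closed densely defined operator. $\mathcal X_\rho(J)=\Omega_\rho\times\mathcal K_{\mathrm{sgl}}(J)$. Interfaces on $\mathcal X_\rho(J)$, all containing $\rho_n=r_n(K)$: diag has also $\mu_j=a_j$; gen has also $m_{ij}=\langle Ae_j,e_i\rangle$ and the values $f(n),c_n$; graph has also $\alpha_{ij}=\alpha_A(v_i,v_j)$ and the finite sets $S_{v_i}$ (injectively coded as natural numbers). Pseudospectrum: $\sigma_\varepsilon(A)=\overline{\{z:\|(A-zI)^{-1}\|>\varepsilon^{-1}\}}$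 (norm $=\infty$ on $\sigma(A)$). Problems: for $\star\in\{\mathrm{diag},\mathrm{gen},\mathrm{graph}\}$, $\mathcal P^\sigma_{J,\star}$ has instance set $\mathcal X_\star(J)$, the corresponding interface, output $\{0,1\}$ (discrete) and target $1$ if $\sigma(A)\cap K=\varnothing$, $0$ otherwise; $\mathcal P^{\sigma_\varepsilon}_{J,\varepsilon,\star}$ is the same with $\sigma_\varepsilon$ in place of $\sigma$. Geometric encodings. An elementary encoding of type $\rho\to\rho'$ is a map $e:\mathcal X_\rho(J)\to\mathcal X_{\rho'}(J)$, $e(A,K)=(R(A),K)$, where $R:\Omega_\rho\to\Omega_{\rho'}$ is a fixed map of one of the following forms (all data fixed, independent of the input): (E1) unitary conjugacy: $\operatorname{op}_{\rho'}(R(A))=U\operatorname{op}_\rho(A)U^{-1}$ for a fixed unitary $U:H_\rho\to H_{\rho'}$; (E2) basis relabeling ($\rho,\rho'\in\{\mathrm{diag},\mathrm{gen}\}$): the same with $U=U_\pi$, $U_\pi e_j=e_{\pi(j)}$, $\pi$ a bijection of $\mathbb N$; (E3) graph relabeling ($\rho=\rho'=\mathrm{graph}$): the same with $U\mathbf 1_v=\mathbf 1_{\alpha(v)}$, $\alpha$ a graph automorphism; (E4) representation inclusion: $\operatorname{op}_{\rho'}(R(A))=W\operatorname{op}_\rho(A)W^{-1}$ with $W:H_\rho\to H_{\rho'}$ a fixed unitary; the two inclusions used are $\mathrm{diag}\to\mathrm{gen}$ with $W=\mathrm{id}$ (a diagonal operator viewed as a general one, with canonical dispersion data $f(n)=n$,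 $c_n=2^{-n}$) and $\mathrm{diag}\to\mathrm{graph}$ with $We_j=\mathbf 1_{v_j}$ (so $\alpha(v_i,v_j)=a_j$ if $i=j$ and $0$ otherwise, with $S_{v_j}=\{v_j\}$); (E5) neutral stabilization: $\operatorname{op}_{\rho'}(R(A))=W(\operatorname{op}_\rho(A)\oplus T_0)W^{-1}$ with a fixed closed densely defined $T_0$ on a Hilbert space $H_0$, a fixed unitary $W:H_\rho\oplus H_0\to H_{\rho'}$, and $\sigma(T_0)\cap J=\varnothing=\sigma_\varepsilon(T_0)\cap J$. The collection of elementary encodings is part of a fixed CH23 geometric structure; it contains the two inclusions displayed in (E4) and is otherwise any collection of maps of the forms (E1)–(E5). A CH23 $(J,\varepsilon)$-neutral geometric encoding is a finite composition (possibly empty, i.e. an identity) of elementary encodings with compatible types. Preorders. For $\mathcal S,\mathcal P\in\mathcal U^\sharp_{2,J,\varepsilon}$ with targets $\Psi,\Xi$ and interfaces $\Lambda_{\mathcal S},\Lambda_{\mathcal P}$, $\mathcal S\le_{\mathrm{raw}}\mathcal P$ means: there are a map $E$ from instances of $\mathcal S$ to instances of $\mathcal P$, a continuous $D:\{0,1\}\to\{0,1\}$ with $D(\Xi(E(x)))=\Psi(x)$ for all $x$, and for every $\lambda\in\Lambda_{\mathcal P}$ finitely many (possibly zero) $\gamma_1,\dots,\gamma_m\in\Lambda_{\mathcal S}$ and an arbitrary map $\vartheta_\lambda$ on their joint image with $\lambda(E(x))=\vartheta_\lambda(\gamma_1(x),\dots,\gamma_m(x))$ for all $x$. $\mathcal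 S\le_{\mathrm{geom}}\mathcal P$ means the same with $E$ required to be a CH23 $(J,\varepsilon)$-neutral geometric encoding. Degrees. For $\mathfrak m\in\{\mathrm{raw},\mathrm{geom}\}$, $\operatorname{MinDeg}^{\mathfrak m}_2(\mathcal U)$ is the set of minimal elements of the partially ordered set obtained from $\{\mathcal P\in\mathcal U:\operatorname{SCI}_{\mathrm G}(\mathcal P)=2\}$ by quotienting $\le_{\mathfrak m}$ by mutual reducibility. Principal means exactly one minimal degree. *)

(* Defs.v *)
(* Mathematical Components and MathComp-Analysis; R : realType, complex numbers R[i]. *)
From HB Require Import structures.
From mathcomp Require Import all_boot all_order all_algebra finmap.
From mathcomp Require Import all_classical all_reals all_analysis.
From mathcomp Require Import complex.
From mathcomp Require Import ring lra.

Set Implicit Arguments.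
Unset Strict Implicit.
Unset Printing Implicit Defensive.

Import Order.TTheory GRing.Theory Num.Theory.
Import numFieldNormedType.Exports.
Import ComplexField.Normc.

Local Open Scope classical_set_scope.
Local Open Scope ring_scope.
Local Open Scope complex_scope.

Section RealSums.
Context {R : realType} {I : choiceType}.
Implicit Types f g p q : I -> R.

Definition esumr p : \bar R := \esum_(i in [set: I]) (p i)%:E.

(* Unconditional sums: positive part minus negative part. The values are
   meaningful on absolutely summable families only. *)
Definition rsum f : R :=
  fine (esumr (fun i => Num.max (f i) 0))
  - fine (esumr (fun i => Num.max (- f i) 0)).

Definition abs_summable f := (esumr (fun i => `|f i|%R) < +oo)%E.

Definition csum (f : I -> R[i]) : R[i] :=
  (rsum (fun i => complex.Re (f i))) +i* (rsum (fun i => complex.Im (f i))).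

Lemma esumr_ge0 p : (forall i, 0 <= p i) -> (0 <= esumr p)%E.
Proof. by move=> p0; apply: esum_ge0 => i _; rewrite lee_fin. Qed.

Lemma le_esumr p q : (forall i, p i <= q i) -> (esumr p <= esumr q)%E.
Proof. by move=> pq; apply: le_esum => i _; rewrite lee_fin. Qed.

Lemma eq_esumr p q : p =1 q -> esumr p = esumr q.
Proof. by move=> pq; apply: eq_esum => i _; rewrite pq. Qed.

Lemma esumrD p q : (forall i, 0 <= p i) -> (forall i, 0 <= q i) ->
  esumr (fun i => p i + q i) = (esumr p + esumr q)%E.
Proof.
by move=> p0 q0; rewrite /esumr -esumD//= => i _; rewrite lee_fin.
Qed.

Lemma esumrZ c p : 0 <= c -> (forall i, 0 <= p i) ->
  esumr (fun i => c * p i) = (c%:E * esumr p)%E.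
Proof.
move=> c0 p0; rewrite /esumr /esum -ereal_supZl//; last first.
  by apply/set0P; exists (\sum_(i \in set0) (p i)%:E)%E; exists set0 => //; exact: fsets_set0.
congr ereal_sup; apply/seteqP; split => t /=.
  move=> [F FI <-]; exists (\sum_(x \in F) (p x)%:E)%E; first by exists F.
  by rewrite ge0_mule_fsumr// => i; rewrite lee_fin.
move=> [_ [F FI <-] <-]; exists F => //.
by rewrite ge0_mule_fsumr// => i; rewrite lee_fin.
Qed.

Lemma esumr_fin p : (forall i, 0 <= p i) -> (esumr p < +oo)%E ->
  esumr p \is a fin_num.
Proof. by move=> p0 h; rewrite ge0_fin_numE// esumr_ge0. Qed.

Lemma esumr_lt p q : (forall i, p i <= q i) -> (esumr q < +oo)%E ->
  (esumr p < +oo)%E.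
Proof. by move=> pq; apply: le_lt_trans; exact: le_esumr. Qed.

Lemma posneg (x : R) : Num.max x 0 - Num.max (- x) 0 = x.
Proof.
case: (ltrgtP x 0) => h.
- by rewrite [Num.max (- x) _](max_idPl _) ?oppr_ge0 ?ltW//; ring.
- by rewrite [Num.max (- x) _](max_idPr _) ?oppr_le0 ?ltW//; ring.
- by rewrite h oppr0 maxxx; ring.
Qed.

Lemma rsumB f p q : (forall i, 0 <= p i) -> (forall i, 0 <= q i) ->
  (esumr p < +oo)%E -> (esumr q < +oo)%E -> (forall i, f i = p i - q i) ->
  rsum f = fine (esumr p) - fine (esumr q).
Proof.
move=> p0 q0 sp sq fE; rewrite /rsum.
set fp := fun i => Num.max (f i) 0; set fn := fun i => Num.max (- f i) 0.
have fp0 i : 0 <= fp i by rewrite /fp le_max lexx orbT.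
have fn0 i : 0 <= fn i by rewrite /fn le_max lexx orbT.
have fpp i : fp i <= p i by rewrite /fp fE ge_max p0 andbT gerBl.
have fnq i : fn i <= q i by rewrite /fn fE opprB ge_max q0 andbT gerBl.
have sfp := esumr_lt fpp sp; have sfn := esumr_lt fnq sq.
have : (esumr fp + esumr q = esumr fn + esumr p)%E.
  rewrite -!esumrD//; apply: eq_esumr => i.
  by have := posneg (f i); have := fE i; rewrite -/(fp i) -/(fn i); lra.
move=> /(congr1 fine); rewrite !fineD ?esumr_fin//; lra.
Qed.

Lemma abs_summable_pos f : abs_summable f ->
  (esumr (fun i => Num.max (f i) 0)%R < +oo)%E.
Proof. by apply: esumr_lt => i; rewrite ge_max ler_norm normr_ge0. Qed.

Lemma abs_summable_neg f : abs_summable f ->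
  (esumr (fun i => Num.max (- f i) 0)%R < +oo)%E.
Proof. by apply: esumr_lt => i; rewrite ge_max -normrN ler_norm normr_ge0. Qed.

Lemma max0_ge0 (x : R) : 0 <= Num.max x 0.
Proof. by rewrite le_max lexx orbT. Qed.

Lemma rsumD f g : abs_summable f -> abs_summable g ->
  rsum (fun i => f i + g i) = rsum f + rsum g.
Proof.
move=> sf sg.
have M := max0_ge0.
have fp := abs_summable_pos sf; have fn := abs_summable_neg sf.
have gp := abs_summable_pos sg; have gn := abs_summable_neg sg.
rewrite (rsumB (p := fun i => Num.max (f i) 0 + Num.max (g i) 0)
               (q := fun i => Num.max (- f i) 0 + Num.max (- g i) 0)).
- by rewrite !esumrD// !fineD ?esumr_fin// /rsum; ring.
- by move=> i; rewrite addr_ge0.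
- by move=> i; rewrite addr_ge0.
- by rewrite esumrD// lte_add_pinfty.
- by rewrite esumrD// lte_add_pinfty.
- by move=> i; have := posneg (f i); have := posneg (g i); lra.
Qed.

Lemma rsumN f : abs_summable f -> rsum (fun i => - f i) = - rsum f.
Proof.
move=> sf; rewrite /rsum opprB; congr (fine _ - fine _).
by apply: eq_esumr => i; rewrite opprK.
Qed.

Lemma abs_summableD f g : abs_summable f -> abs_summable g ->
  abs_summable (fun i => f i + g i).
Proof.
move=> sf sg; have := lte_add_pinfty sf sg; rewrite -esumrD//.
by apply: esumr_lt => i; exact: ler_normD.
Qed.

Lemma abs_summableZ c f : abs_summable f -> abs_summable (fun i => c * f i).
Proof.
move=> sf; rewrite /abs_summable (eq_esumr (q := fun i => `|c| * `|f i|)).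
  rewrite esumrZ//; have := esumr_fin (fun i => normr_ge0 (f i)) sf.
  by case: (esumr _) => // r _; rewrite -EFinM ltry.
by move=> i; rewrite normrM.
Qed.

Lemma abs_summableN f : abs_summable f -> abs_summable (fun i => - f i).
Proof. by apply: esumr_lt => i; rewrite normrN. Qed.

Lemma rsumZ c f : abs_summable f -> rsum (fun i => c * f i) = c * rsum f.
Proof.
wlog c0 : c / 0 <= c => [hw|] sf.
  have [c0|c0] := leP 0 c; first exact: hw.
  have -> : (fun i => c * f i) = (fun i => - ((- c) * f i)).
    by apply/funext => i; ring.
  rewrite rsumN; last exact: abs_summableZ.
  by rewrite hw// ?oppr_ge0 ?ltW//; ring.
have M := max0_ge0.
have fp := abs_summable_pos sf; have fn := abs_summable_neg sf.
have fin p : (forall i, 0 <= p i) -> (esumr p < +oo)%E ->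
    (esumr (fun i => c * p i)%R < +oo)%E.
  move=> p0 sp; rewrite esumrZ//; have := esumr_fin p0 sp.
  by case: (esumr _) => // r _; rewrite -EFinM ltry.
rewrite (rsumB (p := fun i => c * Num.max (f i) 0)
               (q := fun i => c * Num.max (- f i) 0)).
- by rewrite !esumrZ// !fineM ?esumr_fin// /rsum mulrBr.
- by move=> i; rewrite mulr_ge0.
- by move=> i; rewrite mulr_ge0.
- exact: fin.
- exact: fin.
- by move=> i; rewrite -mulrBr posneg.
Qed.

Lemma esumr0 : esumr (fun=> 0) = 0%E.
Proof. by apply: esum1. Qed.

Lemma rsum_ge0 p : (forall i, 0 <= p i) -> (esumr p < +oo)%E ->
  rsum p = fine (esumr p).
Proof.
move=> p0 sp; rewrite (rsumB (p := p) (q := fun=> 0))//.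
- by rewrite esumr0 subr0.
- by rewrite esumr0 ltry.
- by move=> i; rewrite subr0.
Qed.

Lemma rsum0 : rsum (fun=> 0) = 0.
Proof. by rewrite rsum_ge0 ?esumr0// ltry. Qed.

Lemma esumr_eq0 p : (forall i, 0 <= p i) -> esumr p = 0%E -> forall i, p i = 0.
Proof.
move=> p0 sp i; apply/eqP; rewrite eq_le p0 andbT.
have : ((p i)%:E <= esumr p)%E.
  apply: esum_ge; exists [set i]; last by rewrite fsbig_set1.
  by split => //; exact: finite_set1.
by rewrite sp lee_fin.
Qed.

End RealSums.

Section ComplexSums.
Context {R : realType} {I : choiceType}.
Implicit Types f g : I -> R[i].

Definition csummable f :=
  abs_summable (fun i => complex.Re (f i)) /\
  abs_summable (fun i => complex.Im (f i)).

Lemma csumD f g : csummable f -> csummable g ->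
  csum (fun i => f i + g i) = csum f + csum g.
Proof.
move=> [fr fi] [gr gi]; rewrite /csum; simpc; congr (_ +i* _).
  by rewrite -rsumD//; congr rsum; apply/funext => i; case: (f i) (g i) => [? ?] [].
by rewrite -rsumD//; congr rsum; apply/funext => i; case: (f i) (g i) => [? ?] [].
Qed.

Lemma csumZ (c : R[i]) f : csummable f -> csum (fun i => c * f i) = c * csum f.
Proof.
move=> [fr fi]; case: c => a b; rewrite /csum; simpc; congr (_ +i* _).
  rewrite -!rsumZ// -rsumN; last exact: abs_summableZ.
  rewrite -rsumD; [|exact: abs_summableZ|exact/abs_summableN/abs_summableZ].
  by congr rsum; apply/funext => i; case: (f i).
rewrite -!rsumZ// -rsumD; [|exact: abs_summableZ|exact: abs_summableZ].
by congr rsum; apply/funext => i; case: (f i).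
Qed.

Lemma csumJ f : csummable f -> csum (fun i => conjc (f i)) = conjc (csum f).
Proof.
move=> [fr fi]; rewrite /csum /=; congr (_ +i* _).
  by congr rsum; apply/funext => i; case: (f i).
by rewrite -rsumN//; congr rsum; apply/funext => i; case: (f i).
Qed.

Lemma normc_sq (z : R[i]) : normc z ^+ 2 = complex.Re z ^+ 2 + complex.Im z ^+ 2.
Proof. by case: z => a b /=; rewrite sqr_sqrtr// addr_ge0 ?sqr_ge0. Qed.

Lemma esumr_lin (p q s : I -> R) (c d : R) : 0 <= c -> 0 <= d ->
  (forall i, 0 <= p i) -> (forall i, 0 <= q i) ->
  (esumr p < +oo)%E -> (esumr q < +oo)%E ->
  (forall i, s i <= c * p i + d * q i) -> (esumr s < +oo)%E.
Proof.
move=> c0 d0 p0 q0 sp sq /esumr_lt; apply.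
rewrite esumrD => [|i|i]; rewrite ?mulr_ge0// !esumrZ//.
have := esumr_fin p0 sp; have := esumr_fin q0 sq.
by case: (esumr q) => // y _; case: (esumr p) => // x _; rewrite -!EFinM -EFinD ltry.
Qed.

Definition square_summable f := (esumr (fun i => normc (f i) ^+ 2)%R < +oo)%E.

Lemma square_summableD f g : square_summable f -> square_summable g ->
  square_summable (fun i => f i + g i).
Proof.
move=> sf sg; apply: (esumr_lin (c := 2) (d := 2) _ _ _ _ sf sg) => // [i|i|i].
- exact: sqr_ge0.
- exact: sqr_ge0.
- rewrite !normc_sq; case: (f i) (g i) => [a b] [c d] /=.
  have := sqr_ge0 (a - c); have := sqr_ge0 (b - d); nra.
Qed.

Lemma square_summableZ c f : square_summable f ->
  square_summable (fun i => c * f i).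
Proof.
move=> sf.
apply: (esumr_lin (c := normc c ^+ 2) (d := 0) _ _ _ _ sf sf) => // [|i|i|i].
- exact: sqr_ge0.
- exact: sqr_ge0.
- exact: sqr_ge0.
- by rewrite mul0r addr0 normcM exprMn.
Qed.

Lemma square_summable_dot f g : square_summable f -> square_summable g ->
  csummable (fun i => f i * conjc (g i)).
Proof.
move=> sf sg; split;
  apply: (esumr_lin (c := 1) (d := 1) _ _ _ _ sf sg) => // i;
  rewrite ?sqr_ge0// !normc_sq; case: (f i) (g i) => [a b] [c d] /=; simpc => /=.
- have := sqr_ge0 (a - c); have := sqr_ge0 (b - d).
  have := sqr_ge0 (a + c); have := sqr_ge0 (b + d) => *.
  by rewrite ler_norml; apply/andP; split; nra.
- have := sqr_ge0 (a - d); have := sqr_ge0 (b - c).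
  have := sqr_ge0 (a + d); have := sqr_ge0 (b + c) => *.
  by rewrite ler_norml; apply/andP; split; nra.
Qed.

Lemma csum_dotxx f : square_summable f ->
  csum (fun i => f i * conjc (f i)) = (fine (esumr (fun i => normc (f i) ^+ 2)))%:C.
Proof.
move=> sf; rewrite /csum; congr (_ +i* _).
  rewrite -rsum_ge0//; last by move=> i; exact: sqr_ge0.
  by congr rsum; apply/funext => i; rewrite normc_sq; case: (f i) => a b; simpc => /=; ring.
rewrite -(@rsum0 R I); congr rsum; apply/funext => i.
by case: (f i) => a b; simpc => /=; ring.
Qed.

End ComplexSums.

Definition dot_norm (R : realType) (T : Type) (dot : T -> T -> R[i]) (x : T) : R :=
  Num.sqrt (complex.Re (dot x x)).

(* Complex Hilbert spaces; the inner product is linear in its first argument. *)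
Record hilbertSpace (R : realType) := HilbertSpace {
  hcarrier :> lmodType R[i];
  hdot : hcarrier -> hcarrier -> R[i];
  hdotDl : forall x y z, hdot (x + y) z = hdot x z + hdot y z;
  hdotZl : forall a x y, hdot (a *: x) y = a * hdot x y;
  hdotC : forall x y, hdot y x = conjc (hdot x y);
  hdot_ge0 : forall x, 0 <= hdot x x;
  hdot_eq0 : forall x, hdot x x = 0 -> x = 0;
  hcomplete : forall u : nat -> hcarrier,
    (forall e : R, 0 < e -> exists N, forall m n, (N <= m)%N -> (N <= n)%N ->
       dot_norm hdot (u m - u n) < e) ->
    exists l, dot_norm hdot (u n - l) @[n --> \oo] --> (0 : R)
}.

Section L2def.
Variables (R : realType) (I : choiceType).

Definition l2_pred : {pred I -> R[i]} := fun f => `[< square_summable f >].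

Lemma l2_submod_closed : submod_closed l2_pred.
Proof.
split.
  apply/asboolP; rewrite /square_summable.
  rewrite (eq_esumr (q := fun=> 0)) ?esumr0 ?ltry// => i.
  by rewrite normc_sq /= expr0n addr0.
move=> c f g /asboolP sf /asboolP sg; apply/asboolP.
by apply: square_summableD => //; exact: square_summableZ.
Qed.

HB.instance Definition _ := GRing.isSubmodClosed.Build _ _ l2_pred l2_submod_closed.

Record l2 := L2 { l2fun :> I -> R[i]; _ : l2fun \in l2_pred }.

HB.instance Definition _ := [isSub for l2fun].
HB.instance Definition _ := [Choice of l2 by <:].
HB.instance Definition _ := [SubChoice_isSubLmodule of l2 by <:].

Definition l2_dot (x y : l2) : R[i] := csum (fun i => x i * conjc (y i)).

End L2def.

Section L2thm.
Context {R : realType} {I : choiceType}.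
Implicit Types x y z : l2 R I.

Lemma l2P x : square_summable x.
Proof. by have /asboolP := valP x. Qed.

Lemma l2_ext x y : (forall i, x i = y i) -> x = y.
Proof. by move=> xy; apply/val_inj/funext. Qed.

Lemma l2_summable x y : csummable (fun i => x i * conjc (y i)).
Proof. by apply: square_summable_dot; exact: l2P. Qed.

Lemma l2_dotDl x y z : l2_dot (x + y) z = l2_dot x z + l2_dot y z.
Proof.
rewrite -csumD; [|exact: l2_summable..].
by congr csum; apply/funext => i; rewrite mulrDl.
Qed.

Lemma l2_dotZl a x y : l2_dot (a *: x) y = a * l2_dot x y.
Proof.
rewrite -csumZ; last exact: l2_summable.
by congr csum; apply/funext => i; rewrite mulrA.
Qed.

Lemma l2_dotC x y : l2_dot y x = conjc (l2_dot x y).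
Proof.
rewrite -csumJ; last exact: l2_summable.
by congr csum; apply/funext => i; rewrite rmorphM /= conjcK mulrC.
Qed.

Lemma l2_dotxx x : l2_dot x x = (fine (esumr (fun i => normc (x i) ^+ 2)))%:C.
Proof. by apply: csum_dotxx; exact: l2P. Qed.

Lemma l2_dot_ge0 x : 0 <= l2_dot x x.
Proof.
by rewrite l2_dotxx ler0c fine_ge0// esumr_ge0// => i; exact: sqr_ge0.
Qed.

Lemma l2_dot_eq0 x : l2_dot x x = 0 -> x = 0.
Proof.
have x0 i : 0 <= normc (x i) ^+ 2 by exact: sqr_ge0.
rewrite l2_dotxx => -[] h; apply: l2_ext => i /=.
have := @esumr_eq0 _ _ _ x0 _ i.
rewrite -[esumr _]fineK; last exact/esumr_fin/l2P.
by rewrite h => /(_ erefl)/eqP; rewrite sqrf_eq0 => /eqP /eq0_normc.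
Qed.

Lemma l2_norm_sq x :
  dot_norm (@l2_dot R I) x ^+ 2 = fine (esumr (fun i => normc (x i) ^+ 2)).
Proof.
rewrite /dot_norm l2_dotxx /= sqr_sqrtr// fine_ge0// esumr_ge0// => i.
exact: sqr_ge0.
Qed.

Lemma esumr_le_fset (p : I -> R) (M : \bar R) :
  (forall F : {fset I}, ((\sum_(i <- F) p i)%:E <= M)%E) -> (esumr p <= M)%E.
Proof.
move=> h; rewrite ge_ereal_sup//= => _ [F [finF _] <-].
by rewrite fsbig_finite//= sumEFin.
Qed.

Lemma fset_le_esumr (p : I -> R) (F : {fset I}) : (forall i, 0 <= p i) ->
  ((\sum_(i <- F) p i)%:E <= esumr p)%E.
Proof.
move=> p0; apply: esum_ge; exists [set` F]; first by split.
by rewrite fsbig_finite//= set_fsetK sumEFin.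
Qed.

Lemma cauchy_cvgR (v : nat -> R) :
  (forall e, 0 < e -> exists N, forall m n, (N <= m)%N -> (N <= n)%N ->
    `|v m - v n| < e) -> cvgn v.
Proof.
move=> h; apply/cauchy_cvgP/cauchy_exP => e /h[N hN].
by exists (v N); exists N => // n /= Nn; rewrite -ball_normE /=; exact: hN.
Qed.

Lemma l2_complete (u : nat -> l2 R I) :
    (forall e : R, 0 < e -> exists N, forall m n, (N <= m)%N -> (N <= n)%N ->
       dot_norm (@l2_dot R I) (u m - u n) < e) ->
    exists l, dot_norm (@l2_dot R I) (u n - l) @[n --> \oo] --> (0 : R).
Proof.
move=> cu.
have fsum_le m n (F : {fset I}) e : dot_norm (@l2_dot R I) (u m - u n) < e ->
    \sum_(i <- F) normc (u m i - u n i) ^+ 2 <= e ^+ 2.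
  move=> h; have d0 : 0 <= dot_norm (@l2_dot R I) (u m - u n) by exact: sqrtr_ge0.
  apply: (@le_trans _ _ (dot_norm (@l2_dot R I) (u m - u n) ^+ 2)); last first.
    by rewrite ler_sqr ?nnegrE// ltW// (le_lt_trans d0).
  rewrite l2_norm_sq -lee_fin fineK; last first.
    by apply: esumr_fin (l2P _) => i; exact: sqr_ge0.
  by apply: fset_le_esumr => i; exact: sqr_ge0.
have coord i e : 0 < e -> exists N, forall m n, (N <= m)%N -> (N <= n)%N ->
    `|complex.Re (u m i) - complex.Re (u n i)| < e /\
    `|complex.Im (u m i) - complex.Im (u n i)| < e.
  move=> e0; have [|N hN] := cu (e / 2); first by rewrite divr_gt0.
  exists N => m n Nm Nn; have := fsum_le _ _ [fset i]%fset _ (hN _ _ Nm Nn).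
  rewrite big_seq_fset1 normc_sq; case: (u m i) (u n i) => [a b] [c d] /= h.
  have e2 : 0 < e ^+ 2 by rewrite exprn_gt0.
  have aux (t : R) : t ^+ 2 <= (e / 2) ^+ 2 -> `|t| < e.
    rewrite -(real_normK (num_real t)) ler_sqr ?nnegrE//; last by lra.
    by move=> ht; apply: (le_lt_trans ht); lra.
  split; apply: aux; apply: le_trans h; rewrite ?lerDl ?lerDr ?sqr_ge0//.
have cRe i : cvgn (fun n => complex.Re (u n i)).
  apply: cauchy_cvgR => e /(coord i)[N hN]; exists N => m n Nm Nn.
  by case: (hN _ _ Nm Nn).
have cIm i : cvgn (fun n => complex.Im (u n i)).
  apply: cauchy_cvgR => e /(coord i)[N hN]; exists N => m n Nm Nn.
  by case: (hN _ _ Nm Nn).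
pose f (i : I) : R[i] := (limn (fun n => complex.Re (u n i)))
         +i* (limn (fun n => complex.Im (u n i))).
have sqcvg m i : normc (u m i - u n i) ^+ 2 @[n --> \oo] -->
    normc (u m i - f i) ^+ 2.
  have ReB (z w : R[i]) : complex.Re (z - w) = complex.Re z - complex.Re w.
    by case: z w => ? ? [].
  have ImB (z w : R[i]) : complex.Im (z - w) = complex.Im z - complex.Im w.
    by case: z w => ? ? [].
  rewrite normc_sq ReB ImB; under eq_fun do rewrite normc_sq ReB ImB.
  have sq (v : nat -> R) (c : R) : cvgn v ->
      (c - v n) ^+ 2 @[n --> \oo] --> (c - limn v) ^+ 2.
    move=> cv; rewrite expr2; under eq_fun do rewrite expr2.
    by apply: cvgM; apply: cvgB => //; exact: cvg_cst.
  by apply: cvgD; [exact: (sq _ _ (cRe i))|exact: (sq _ _ (cIm i))].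
have sumcvg m (r : seq I) : \sum_(i <- r) normc (u m i - u n i) ^+ 2 @[n --> \oo] -->
    \sum_(i <- r) normc (u m i - f i) ^+ 2.
  elim: r => [|i r IH]; first by under eq_fun do rewrite big_nil; rewrite big_nil; exact: cvg_cst.
  by under eq_fun do rewrite big_cons; rewrite big_cons; apply: cvgD; [exact: sqcvg|exact: IH].
have tail e : 0 < e -> exists N, forall m, (N <= m)%N ->
    (esumr (fun i => normc (u m i - f i) ^+ 2)%R <= (e ^+ 2)%:E)%E.
  move=> /cu[N hN]; exists N => m Nm; apply: esumr_le_fset => F.
  rewrite lee_fin.
  have /cvg_lim <-// := sumcvg m F; apply: limr_le.
    by apply/cvg_ex; eexists; exact: (sumcvg m F).
  exists N => // n /= Nn; apply: fsum_le; exact: hN.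
have fl2 : f \in @l2_pred R I.
  have [N hN0] := tail 1 ltr01; have hN := hN0 N (leqnn N); apply/asboolP.
  have -> : f = (fun i => u N i + (-1) * (u N i - f i)).
    by apply/funext => i; ring.
  apply: square_summableD; first exact: l2P.
  by apply: square_summableZ; apply: le_lt_trans hN _; rewrite ltry.
exists (L2 fl2); apply/cvgr0Pnorm_le => e e0.
have [N hN] := tail e e0; exists N => // m /= /hN hm.
rewrite ger0_norm ?sqrtr_ge0//.
rewrite -(@ler_sqr _ (dot_norm _ _)) ?nnegrE ?sqrtr_ge0 ?(ltW e0)//.
rewrite l2_norm_sq -lee_fin fineK; last first.
  by apply: esumr_fin (l2P _) => i; exact: sqr_ge0.
exact: hm.
Qed.

End L2thm.

Definition l2_hilbert (R : realType) (I : choiceType) : hilbertSpace R :=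
  HilbertSpace (@l2_dotDl R I) (@l2_dotZl R I) (@l2_dotC R I) (@l2_dot_ge0 R I)
    (@l2_dot_eq0 R I) (@l2_complete R I).

Section HilbertBasics.
Context {R : realType} {H : hilbertSpace R}.
Implicit Types x y z : H.

Definition hnorm x : R := dot_norm (@hdot R H) x.

Definition hcvg (u : nat -> H) (l : H) := hnorm (u n - l) @[n --> \oo] --> (0 : R).

Lemma hnorm_ge0 x : 0 <= hnorm x. Proof. exact: sqrtr_ge0. Qed.

Lemma hdotDr x y z : hdot x (y + z) = hdot x y + hdot x z.
Proof. by rewrite hdotC hdotDl rmorphD /= -!hdotC. Qed.

Lemma hdotZr a x y : hdot x (a *: y) = conjc a * hdot x y.
Proof. by rewrite hdotC hdotZl rmorphM /= -hdotC. Qed.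

Lemma hdot0l y : hdot 0 y = 0.
Proof. by rewrite -(scale0r 0) hdotZl mul0r. Qed.

Lemma hdot0r y : hdot y 0 = 0.
Proof. by rewrite hdotC hdot0l conjc0. Qed.

Lemma hdotNl x y : hdot (- x) y = - hdot x y.
Proof. by rewrite -scaleN1r hdotZl mulN1r. Qed.

Lemma hdotNr x y : hdot x (- y) = - hdot x y.
Proof. by rewrite hdotC hdotNl rmorphN /= -hdotC. Qed.

Lemma hnorm_sqE x : (hnorm x ^+ 2)%:C = hdot x x.
Proof.
have := hdot_ge0 x; rewrite /hnorm /dot_norm; case: (hdot x x) => a b.
by rewrite lecE /= => /andP[/eqP -> a0]; rewrite sqr_sqrtr.
Qed.

Lemma hnorm_eq0 x : hnorm x = 0 -> x = 0.
Proof. by move=> h; apply: hdot_eq0; rewrite -hnorm_sqE h expr0n. Qed.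

Definition lin_span (I : choiceType) (e : I -> H) : set H :=
  [set x | exists (F : {fset I}) (c : I -> R[i]), x = \sum_(i <- F) c i *: e i].

End HilbertBasics.

Definition unitary (R : realType) (H1 H2 : hilbertSpace R) (U : H1 -> H2) : Prop :=
  [/\ linear U, forall x y, hdot (U x) (U y) = hdot x y & forall y, exists x, U x = y].

Definition opnorm (R : realType) (H1 H2 : hilbertSpace R) (T : H1 -> H2) : \bar R :=
  ereal_sup [set (hnorm (T x))%:E | x in [set x | hnorm x <= 1]].

(* Unbounded operators: partial linear maps, extended by 0 outside the domain so
   that equality of operators is equality of partial maps. *)
Record operator (R : realType) (H : hilbertSpace R) := Operator {
  dom : set H;
  app :> H -> H;
  dom0 : dom 0;
  dom_lin : forall a x y, dom x -> dom y -> dom (a *: x + y);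
  app_lin : forall a x y, dom x -> dom y -> app (a *: x + y) = a *: app x + app y;
  app_out : forall x, ~ dom x -> app x = 0
}.

Section Operators.
Context {R : realType} {H : hilbertSpace R}.
Implicit Types A B : operator H.

Definition densely_defined A :=
  forall x e, 0 < e -> exists2 y, dom A y & hnorm (x - y) < e.

Definition closed_operator A := forall (u : nat -> H) x y,
  (forall n, dom A (u n)) -> hcvg u x -> hcvg (fun n => A (u n)) y ->
  dom A x /\ A x = y.

Definition core A (S : set H) := S `<=` dom A /\
  forall x, dom A x -> exists u : nat -> H,
    [/\ forall n, S (u n), hcvg u x & hcvg (fun n => A (u n)) (A x)].

(* The set-theoretic inverse of [A - z I], total by convention; it is meaningful
   when [A - z I] is a bijection from [dom A] onto [H]. *)
Definition resolvent A (z : R[i]) (y : H) : H :=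
  xget 0 [set x | dom A x /\ A x - z *: x = y].

Definition resolvent_set A : set R[i] :=
  [set z | set_bij (dom A) setT (fun x => A x - z *: x) /\
           (opnorm (resolvent A z) < +oo)%E].

Definition spectrum A : set R[i] := ~` resolvent_set A.

Definition resolvent_norm A (z : R[i]) : \bar R :=
  if `[< spectrum A z >] then +oo%E else opnorm (resolvent A z).

(* [R[i]^o] is [R[i]] with its usual topology. *)
Definition pseudospectrum (eps : R) A : set R[i] :=
  closure ([set z | ((eps^-1)%:E < resolvent_norm A z)%E] : set R[i]^o).

Lemma dom_lin0 A a x : dom A x -> dom A (a *: x).
Proof. by move=> /(dom_lin a) /(_ (dom0 A)); rewrite addr0. Qed.

Lemma app0 A : A 0 = 0.
Proof.
have := app_lin 1 (dom0 A) (dom0 A); rewrite !scale1r addr0.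
by move=> e; apply: (addrI (A 0)); rewrite -e addr0.
Qed.

Lemma operator_ext A B : dom A = dom B -> (forall x, dom A x -> A x = B x) -> A = B.
Proof.
case: A B => [D f ? ? ? fo] [E g ? ? ? go] /= DE; subst E => fg.
have fgE : f = g.
  apply/funext => x; have [Dx|nDx] := pselect (D x); first exact: fg.
  by rewrite fo ?go.
subst g; congr Operator; exact: Prop_irrelevance.
Qed.

End Operators.

(* Closed densely defined operators. *)
Record cdop (R : realType) (H : hilbertSpace R) := CDOp {
  cd_op :> operator H;
  cd_closed : closed_operator cd_op;
  cd_dense : densely_defined cd_op
}.

Section Adjoint.
Context {R : realType} {H : hilbertSpace R}.
Variable A : cdop H.

Definition adjoint_rel (y z : H) := forall x, dom A x -> hdot (A x) y = hdot x z.

Definition adjoint_dom : set H := [set y | exists z, adjoint_rel y z].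

Definition adjoint_app (y : H) : H := xget 0 [set z | adjoint_rel y z].

Lemma dense_orth (w : H) : (forall x, dom A x -> hdot x w = 0) -> w = 0.
Proof.
move=> hw; apply: hnorm_eq0; apply/eqP; rewrite eq_le hnorm_ge0 andbT.
rewrite leNgt; apply/negP => w0.
have [x Ax] := @cd_dense _ _ A w _ w0; apply/negP; rewrite -leNgt.
rewrite -ler_sqr ?nnegrE ?hnorm_ge0// -lecR !hnorm_sqE.
rewrite hdotDl !hdotDr !hdotNl !hdotNr (hdotC x w) (hw _ Ax) conjc0 !oppr0 opprK.
by rewrite add0r addr0 lerDl hdot_ge0.
Qed.

Lemma adjoint_rel_fun y z z' : adjoint_rel y z -> adjoint_rel y z' -> z = z'.
Proof.
move=> h h'; apply/eqP; rewrite -subr_eq0; apply/eqP/dense_orth => x Ax.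
by rewrite hdotDr hdotNr -h// -h'// subrr.
Qed.

Lemma adjoint_appP y z : adjoint_rel y z -> adjoint_app y = z.
Proof.
move=> h; apply: (@adjoint_rel_fun y) => //.
by rewrite /adjoint_app; case: xgetP => // /(_ z).
Qed.

Lemma adjoint_rel_lin a x y z w : adjoint_rel x z -> adjoint_rel y w ->
  adjoint_rel (a *: x + y) (a *: z + w).
Proof. by move=> h h' t At; rewrite !hdotDr !hdotZr h// h'. Qed.

Lemma adjoint_dom0 : adjoint_dom 0.
Proof. by exists 0 => x _; rewrite !hdot0r. Qed.

Lemma adjoint_dom_lin a x y : adjoint_dom x -> adjoint_dom y ->
  adjoint_dom (a *: x + y).
Proof.
by move=> [z h] [w h']; exists (a *: z + w); exact: adjoint_rel_lin.
Qed.

Lemma adjoint_app_lin a x y : adjoint_dom x -> adjoint_dom y ->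
  adjoint_app (a *: x + y) = a *: adjoint_app x + adjoint_app y.
Proof.
move=> [z h] [w h']; rewrite (adjoint_appP h) (adjoint_appP h').
exact/adjoint_appP/adjoint_rel_lin.
Qed.

Lemma adjoint_app_out x : ~ adjoint_dom x -> adjoint_app x = 0.
Proof.
by move=> h; rewrite /adjoint_app; case: xgetP => // z _ hz; case: h; exists z.
Qed.

Definition adjoint : operator H :=
  Operator adjoint_dom0 adjoint_dom_lin adjoint_app_lin adjoint_app_out.

End Adjoint.

(* [B = U A U^-1]; only meaningful for a bijection [U]. *)
Definition conjugate_by (R : realType) (H1 H2 : hilbertSpace R) (U : H1 -> H2)
    (A : operator H1) (B : operator H2) : Prop :=
  dom B = U @` dom A /\ forall x, dom A x -> B (U x) = U (A x).

Section DirectSum.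
Context {R : realType} (H1 H2 : hilbertSpace R).

Definition hsum_dot (x y : H1 * H2) : R[i] := hdot x.1 y.1 + hdot x.2 y.2.

Lemma hsum_dotDl x y z : hsum_dot (x + y) z = hsum_dot x z + hsum_dot y z.
Proof. by rewrite /hsum_dot /= !hdotDl addrACA. Qed.

Lemma hsum_dotZl a x y : hsum_dot (a *: x) y = a * hsum_dot x y.
Proof. by rewrite /hsum_dot /= !hdotZl mulrDr. Qed.

Lemma hsum_dotC x y : hsum_dot y x = conjc (hsum_dot x y).
Proof. by rewrite /hsum_dot rmorphD /= -!hdotC. Qed.

Lemma hsum_dot_ge0 x : 0 <= hsum_dot x x.
Proof. by rewrite addr_ge0 ?hdot_ge0. Qed.

Lemma hsum_dot_eq0 x : hsum_dot x x = 0 -> x = 0.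
Proof.
move/eqP; rewrite paddr_eq0 ?hdot_ge0// => /andP[/eqP h1 /eqP h2].
by rewrite [x]surjective_pairing (hdot_eq0 h1) (hdot_eq0 h2).
Qed.

Lemma hsum_norm_sq x :
  dot_norm hsum_dot x ^+ 2 = hnorm x.1 ^+ 2 + hnorm x.2 ^+ 2.
Proof.
rewrite /dot_norm /hsum_dot -!hnorm_sqE -rmorphD /= sqr_sqrtr//.
by rewrite addr_ge0 ?sqr_ge0.
Qed.

Lemma hsum_complete (u : nat -> H1 * H2) :
    (forall e : R, 0 < e -> exists N, forall m n, (N <= m)%N -> (N <= n)%N ->
       dot_norm hsum_dot (u m - u n) < e) ->
    exists l, dot_norm hsum_dot (u n - l) @[n --> \oo] --> (0 : R).
Proof.
move=> cu.
have le1 x : hnorm x.1 <= dot_norm hsum_dot x.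
  rewrite -ler_sqr ?nnegrE ?hnorm_ge0 ?sqrtr_ge0// hsum_norm_sq lerDl.
  exact: sqr_ge0.
have le2 x : hnorm x.2 <= dot_norm hsum_dot x.
  rewrite -ler_sqr ?nnegrE ?hnorm_ge0 ?sqrtr_ge0// hsum_norm_sq lerDr.
  exact: sqr_ge0.
have [|l1 h1] := @hcomplete _ H1 (fun n => (u n).1).
  move=> e /cu[N hN]; exists N => m n Nm Nn.
  exact: le_lt_trans (le1 (u m - u n)) (hN _ _ Nm Nn).
have [|l2 h2] := @hcomplete _ H2 (fun n => (u n).2).
  move=> e /cu[N hN]; exists N => m n Nm Nn.
  exact: le_lt_trans (le2 (u m - u n)) (hN _ _ Nm Nn).
exists (l1, l2).
have le12 x : dot_norm hsum_dot x <= hnorm x.1 + hnorm x.2.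
  rewrite -ler_sqr ?nnegrE ?sqrtr_ge0 ?addr_ge0 ?hnorm_ge0// hsum_norm_sq.
  by rewrite sqrrD addrAC lerDl mulrn_wge0// mulr_ge0 ?hnorm_ge0.
apply: (@squeeze_cvgr _ _ _ _ (fun=> 0)
  (fun n => hnorm (u n - (l1, l2)).1 + hnorm (u n - (l1, l2)).2)).
- by apply: nearW => n; rewrite sqrtr_ge0 le12.
- exact: cvg_cst.
- by rewrite -(addr0 0); apply: cvgD.
Qed.

Definition hsum : hilbertSpace R :=
  HilbertSpace hsum_dotDl hsum_dotZl hsum_dotC hsum_dot_ge0 hsum_dot_eq0
    hsum_complete.

Variables (A : operator H1) (B : operator H2).

Definition opsum_dom : set hsum := [set x | dom A x.1 /\ dom B x.2].

Definition opsum_app (x : hsum) : hsum :=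
  if `[< opsum_dom x >] then (A x.1, B x.2) else 0.

Lemma opsum_dom0 : opsum_dom 0.
Proof. by split; exact: dom0. Qed.

Lemma opsum_dom_lin a x y : opsum_dom x -> opsum_dom y -> opsum_dom (a *: x + y).
Proof. by move=> [? ?] [? ?]; split; exact: dom_lin. Qed.

Lemma opsum_app_lin a x y : opsum_dom x -> opsum_dom y ->
  opsum_app (a *: x + y) = a *: opsum_app x + opsum_app y.
Proof.
move=> dx dy; have dxy := opsum_dom_lin a dx dy; rewrite /opsum_app.
rewrite !asboolT//; case: dx dy => [? ?] [? ?].
by rewrite /= !app_lin.
Qed.

Lemma opsum_app_out x : ~ opsum_dom x -> opsum_app x = 0.
Proof. by move=> h; rewrite /opsum_app asboolF. Qed.

Definition opsum : operator hsum :=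
  Operator opsum_dom0 opsum_dom_lin opsum_app_lin opsum_app_out.

End DirectSum.

Section L2basis.
Context {R : realType} {I : choiceType}.
Local Notation H := (l2_hilbert R I).

Lemma esumr_set1 (p : I -> R) (i : I) : (forall j, j != i -> p j = 0) ->
  0 <= p i -> esumr p = (p i)%:E.
Proof.
move=> p0 pi0; rewrite /esumr.
transitivity (\esum_(j in [set i]) (p j)%:E)%E; last by rewrite esum_set1// lee_fin.
rewrite [RHS]esum_mkcond; apply: eq_esum => j _.
case: ifPn => //; rewrite notin_setE /= => /eqP ji; by rewrite p0.
Qed.

Lemma rsum_set1 (f : I -> R) (i : I) : (forall j, j != i -> f j = 0) ->
  rsum f = f i.
Proof.
move=> f0; rewrite /rsum !(@esumr_set1 _ i) ?max0_ge0//=; first exact: posneg.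
- by move=> j /f0 ->; rewrite oppr0 maxxx.
- by move=> j /f0 ->; rewrite maxxx.
Qed.

Lemma csum_set1 (f : I -> R[i]) (i : I) : (forall j, j != i -> f j = 0) ->
  csum f = f i.
Proof.
move=> f0; rewrite /csum !(@rsum_set1 _ i); last 2 first.
- by move=> j /f0 ->.
- by move=> j /f0 ->.
by case: (f i).
Qed.

Lemma l2_basis_subproof (i : I) :
  (fun j => (j == i)%:R : R[i]) \in @l2_pred R I.
Proof.
apply/asboolP; rewrite /square_summable (@esumr_set1 _ i) ?ltry ?sqr_ge0//.
by move=> j /negPf ->; rewrite normc0 expr0n.
Qed.

Definition l2_basis (i : I) : H := L2 (l2_basis_subproof i).

Lemma hdot_basis (x : H) (i : I) : hdot x (l2_basis i) = (x : l2 R I) i.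
Proof.
rewrite [LHS](@csum_set1 _ i); last first.
  by move=> j /negPf ji; rewrite [X in _ * conjc X]/= ji conjc0 mulr0.
by rewrite [X in _ * conjc X]/= eqxx conjc1 mulr1.
Qed.

Lemma lin_span_sum (A : operator H) (F : seq I) (c : I -> R[i]) :
  (forall i, dom A (l2_basis i)) ->
  dom A (\sum_(i <- F) c i *: l2_basis i) /\
  A (\sum_(i <- F) c i *: l2_basis i) = \sum_(i <- F) c i *: A (l2_basis i).
Proof.
move=> dA; elim: F => [|i F [IHd IHe]].
  by rewrite !big_nil app0; split => //; exact: dom0.
by rewrite !big_cons app_lin// IHe; split => //; exact: dom_lin.
Qed.

Lemma lin_span_basis (i : I) : lin_span l2_basis (l2_basis i).
Proof.
by exists [fset i]%fset, (fun=> 1); rewrite big_seq_fset1 scale1r.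
Qed.

Lemma cdop_basis_sub (A B : cdop H) :
  core A (lin_span l2_basis) -> core B (lin_span l2_basis) ->
  (forall i j, hdot (A (l2_basis j)) (l2_basis i) =
               hdot (B (l2_basis j)) (l2_basis i)) ->
  forall x, dom A x -> dom B x /\ B x = A x.
Proof.
move=> [dA cA] [dB cB] AB x /cA[u [us ux Aux]].
suff BA : (fun n => B (u n)) = (fun n => A (u n)).
  apply: (@cd_closed _ _ B u x (A x)) => [n||]; first exact/dB/us.
    exact: ux.
  by rewrite BA.
have ABe j : B (l2_basis j) = A (l2_basis j).
  by apply: l2_ext => i; have := AB i j; rewrite !hdot_basis.
apply/funext => n; have [F [c ->]] := us n.
have [|_ ->] := @lin_span_sum B F c; first by move=> i; exact/dB/lin_span_basis.
have [|_ ->] := @lin_span_sum A F c; first by move=> i; exact/dA/lin_span_basis.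
by apply: eq_bigr => i _; rewrite ABe.
Qed.

Lemma operator_basis_ext (A B : cdop H) :
  core A (lin_span l2_basis) -> core B (lin_span l2_basis) ->
  (forall i j, hdot (A (l2_basis j)) (l2_basis i) =
               hdot (B (l2_basis j)) (l2_basis i)) ->
  cd_op A = cd_op B.
Proof.
move=> cA cB AB; have sAB := cdop_basis_sub cA cB AB.
have sBA := cdop_basis_sub cB cA (fun i j => esym (AB i j)).
apply: operator_ext => [|x /sAB[] //].
by apply/seteqP; split => x; [move/sAB => []|move/sBA => []].
Qed.

Lemma l2_linE (c : R[i]) (x y : H) j :
  (c *: x + y : l2 R I) j = c * (x : l2 R I) j + (y : l2 R I) j.
Proof. by []. Qed.

Lemma l2_subE (x y : H) j : (x - y : l2 R I) j = (x : l2 R I) j - (y : l2 R I) j.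
Proof. by []. Qed.

Section Diagonal.
Variable a : I -> R[i].

(* Maximal diagonal operator with diagonal [a]. *)
Definition diag_dom : set H := [set x | square_summable (fun j => a j * (x : l2 R I) j)].

Definition diag_app (x : H) : H :=
  match pselect (diag_dom x) with
  | left h => L2 (asboolT h)
  | right _ => 0
  end.

Lemma diag_appE (x : H) j : diag_dom x -> (diag_app x : l2 R I) j = a j * (x : l2 R I) j.
Proof. by move=> h; rewrite /diag_app; case: pselect. Qed.

Lemma diag_dom0 : diag_dom 0.
Proof.
rewrite /diag_dom /= /square_summable (eq_esumr (q := fun=> 0)) ?esumr0 ?ltry// => j.
by rewrite mulr0 normc0 expr0n.
Qed.

Lemma diag_dom_lin c x y : diag_dom x -> diag_dom y -> diag_dom (c *: x + y).
Proof.
move=> dx dy; have := square_summableD (square_summableZ c dx) dy.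
rewrite /diag_dom /= (_ : (fun i => _) = (fun j => a j * (c * (x : l2 R I) j + (y : l2 R I) j)))//.
by apply/funext => j; ring.
Qed.

Lemma diag_app_lin c x y : diag_dom x -> diag_dom y ->
  diag_app (c *: x + y) = c *: diag_app x + diag_app y.
Proof.
move=> dx dy; apply: l2_ext => j; rewrite diag_appE; last exact: diag_dom_lin.
by rewrite !l2_linE !diag_appE//; ring.
Qed.

Lemma diag_app_out x : ~ diag_dom x -> diag_app x = 0.
Proof. by rewrite /diag_app; case: pselect. Qed.

Definition diag_op : operator H :=
  Operator diag_dom0 diag_dom_lin diag_app_lin diag_app_out.

Lemma hnorm_l2_sq (x : H) : hnorm x ^+ 2 = fine (esumr (fun i => normc ((x : l2 R I) i) ^+ 2)).
Proof. exact: l2_norm_sq. Qed.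

Lemma coord_le (x : H) i : normc ((x : l2 R I) i) <= hnorm x.
Proof.
rewrite -ler_sqr ?nnegrE ?hnorm_ge0//; last by case: (_ i) => ? ?; exact: sqrtr_ge0.
rewrite hnorm_l2_sq -lee_fin fineK; last first.
  by apply: esumr_fin (l2P _) => j; exact: sqr_ge0.
have := @fset_le_esumr R I (fun i => normc ((x : l2 R I) i) ^+ 2) [fset i]%fset.
by rewrite big_seq_fset1; apply => j; exact: sqr_ge0.
Qed.

Lemma diag_closed : closed_operator diag_op.
Proof.
move=> u x y du ux Auy.
have E j : a j * (x : l2 R I) j = (y : l2 R I) j.
  apply/eqP; rewrite -subr_eq0; apply/eqP/eq0_normc/eqP.
  rewrite eq_le; apply/andP; split; last by case: (_ - _) => ? ?; exact: sqrtr_ge0.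
  have cv : normc (a j) * hnorm (u n - x) + hnorm (diag_op (u n) - y) @[n --> \oo]
            --> normc (a j) * 0 + 0.
    by apply: cvgD => //; apply: cvgM => //; exact: cvg_cst.
  have <- : limn (fun n => normc (a j) * hnorm (u n - x) + hnorm (diag_op (u n) - y)) = 0.
    by rewrite (cvg_lim _ cv)// mulr0 addr0.
  apply: limr_ge; first by apply/cvg_ex; eexists; exact: cv.
  apply: nearW => n.
  have -> : a j * (x : l2 R I) j - (y : l2 R I) j =
      - (a j * (u n - x : l2 R I) j) + (diag_op (u n) - y : l2 R I) j.
    have := diag_appE j (du n); rewrite !l2_subE => ->; ring.
  apply: (le_trans (le_normcD _ _)); rewrite normcN normcM lerD//.
    by rewrite ler_wpM2l ?coord_le//; case: (a j) => ? ?; exact: sqrtr_ge0.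
  exact: coord_le.
have dx : diag_dom x.
  rewrite /diag_dom /= (_ : (fun j => _) = (y : l2 R I) :> (I -> R[i])); first exact: l2P.
  by apply/funext => j; exact: E.
by split => //; apply: l2_ext => j; rewrite -E; exact: diag_appE.
Qed.

Lemma l2_truncate_subproof (x : H) (F : {fset I}) :
  (fun i => if i \in F then (x : l2 R I) i else 0) \in @l2_pred R I.
Proof.
apply/asboolP; apply: (esumr_lt _ (l2P x)) => i.
by case: ifP => // _; rewrite normc0 expr0n sqr_ge0.
Qed.

Definition l2_truncate (x : H) (F : {fset I}) : H := L2 (l2_truncate_subproof x F).

Lemma l2_truncate_approx (x : H) (e : R) : 0 < e ->
  exists F : {fset I}, hnorm (x - l2_truncate x F) < e.
Proof.
move=> e0; pose p i := normc ((x : l2 R I) i) ^+ 2.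
have p0 i : 0 <= p i by exact: sqr_ge0.
have pfin : esumr p \is a fin_num := esumr_fin p0 (l2P x).
have e2 : 0 < e ^+ 2 by rewrite exprn_gt0.
have : (esumr p - (e ^+ 2)%:E < esumr p)%E by rewrite lteBlDr// lteDl// lte_fin.
rewrite {2}/esumr => /ereal_sup_gt[_ [X [Xfin _] <-] hX].
exists (fset_set X); rewrite -ltr_sqr ?nnegrE ?hnorm_ge0 ?(ltW e0)//.
rewrite hnorm_l2_sq -lte_fin fineK; last first.
  by apply: esumr_fin (l2P _) => j; exact: sqr_ge0.
pose pin i := if i \in fset_set X then p i else 0.
pose pout i := if i \in fset_set X then 0 else p i.
have pin0 i : 0 <= pin i by rewrite /pin; case: ifP.
have pout0 i : 0 <= pout i by rewrite /pout; case: ifP.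
rewrite (eq_esumr (q := pout)); last first.
  move=> i; rewrite l2_subE /pout /p [X in _ - X]/=.
  by case: ifP => _; rewrite ?subr0// subrr normc0 expr0n.
have pE : esumr p = (esumr pin + esumr pout)%E.
  rewrite -esumrD//; apply: eq_esumr => i; rewrite /pin /pout.
  by case: ifP; rewrite ?addr0 ?add0r.
have hin : (\sum_(i \in X) (p i)%:E <= esumr pin)%E.
  apply: esum_ge; exists X; first by split.
  by apply: lee_fsum => // i Xi; rewrite /pin in_fset_set// mem_set.
have := lt_le_trans hX hin; rewrite pE.
have : esumr pin \is a fin_num.
  apply: esumr_fin => //; apply: (esumr_lt _ (l2P x)) => i.
  by rewrite /pin; case: ifP => // _; exact: sqr_ge0.
have : esumr pout \is a fin_num.
  apply: esumr_fin => //; apply: (esumr_lt _ (l2P x)) => i.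
  by rewrite /pout; case: ifP => // _; exact: sqr_ge0.
case: (esumr pout) => // t _; case: (esumr pin) => // s _.
by rewrite /= !lte_fin; lra.
Qed.

Lemma esumr_fset_lt (p : I -> R) (F : {fset I}) : (forall i, 0 <= p i) ->
  (forall i, i \notin F -> p i = 0) -> (esumr p < +oo)%E.
Proof.
move=> p0 pF; apply: (@le_lt_trans _ _ (\esum_(i in [set` F]) (p i)%:E)%E).
  rewrite [leRHS]esum_mkcond; apply: le_esum => i _; rewrite mem_setE.
  by case: ifPn => // /pF ->.
rewrite esum_fset//; last by move=> i _; rewrite lee_fin.
by rewrite fsbig_finite//= sumEFin ltry.
Qed.

Lemma diag_dense : densely_defined diag_op.
Proof.
move=> x e e0; have [F hF] := l2_truncate_approx x e0.
exists (l2_truncate x F) => //; rewrite /= /diag_dom /= /square_summable.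
apply: (@esumr_fset_lt _ F) => [i|i /negPf ->]; first exact: sqr_ge0.
by rewrite mulr0 normc0 expr0n.
Qed.

Definition diag_cdop : cdop H := CDOp diag_closed diag_dense.
End Diagonal.
End L2basis.

Record sci_problem (R : realType) := SCIProblem {
  inst : Type;
  out : metricType R;
  target : inst -> out;
  interface : set (inst -> R[i]);
  interface_separates : forall x y,
    (forall l, interface l -> l x = l y) -> target x = target y
}.

Arguments target {R} s x.
Arguments interface {R} s _.

Record general_algorithm (R : realType) (P : sci_problem R) := GeneralAlgorithm {
  alg_out :> inst P -> out P;
  alg_read : inst P -> set (inst P -> R[i]);
  alg_read_sub : forall x, alg_read x `<=` interface P;
  alg_read_finite : forall x, finite_set (alg_read x);
  alg_consistent : forall x y, (forall l, alg_read x l -> l y = l x) ->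
    alg_out y = alg_out x /\ alg_read y = alg_read x
}.

Fixpoint iterated_limit (T : topologicalType) (k : nat) :
    (k.-tuple nat -> T) -> T -> Prop :=
  match k with
  | 0 => fun u l => u [tuple] = l
  | k'.+1 => fun u l => exists2 v : nat -> T,
      (forall n, iterated_limit (fun s : k'.-tuple nat => u [tuple of n :: s]) (v n))
      & v n @[n --> \oo] --> l
  end.

Definition has_tower (R : realType) (P : sci_problem R) (k : nat) : Prop :=
  exists Gam : k.-tuple nat -> general_algorithm P,
    forall x, iterated_limit (fun s => Gam s x) (target P x).

Definition SCI_G (R : realType) (P : sci_problem R) : option nat :=
  match pselect (exists k, `[< has_tower P k >]) with
  | left h => Some (ex_minn h)
  | right _ => None
  end.

(* [theta] is total, which does not matter: every map on the joint image of the
   [g i] extends to the whole space. *)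
Definition reduces_via (R : realType) (S P : sci_problem R)
    (E : inst S -> inst P) : Prop :=
  (exists2 D : out P -> out S, continuous D &
     forall x, D (target P (E x)) = target S x) /\
  (forall l, interface P l ->
     exists (m : nat) (g : 'I_m -> inst S -> R[i]) (theta : ('I_m -> R[i]) -> R[i]),
       (forall i, interface S (g i)) /\
       (forall x, l (E x) = theta (fun i => g i x))).

Section MinimalDegrees.
Variables (R : realType) (T : Type) (problem : T -> sci_problem R).
Variable le : T -> T -> Prop.

(* [T] indexes the problems of an ambient, with [le] a preorder on indices. A
   degree is a class of mutually reducible indices of height-2 problems. *)
Definition level2 : set T := [set p | SCI_G (problem p) = Some 2%N].

Definition degree (p : T) : set T := [set q | [/\ level2 q, le p q & le q p]].

Definition degrees : set (set T) := degree @` level2.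

Definition degree_le (C D : set T) : Prop := exists p q, [/\ C p, D q & le p q].

Definition MinDeg2 : set (set T) :=
  [set C | degrees C /\ forall D, degrees D -> degree_le D C -> D = C].

Definition principal : Prop := exists! C, MinDeg2 C.

End MinimalDegrees.

(* {0, 1} with the discrete metric, 1 being [true]. *)
Definition decision (R : realType) : Type := bool.

Section DecisionMetric.
Variable R : realType.

HB.instance Definition _ := Choice.copy (decision R) bool.

Definition decision_dist (x y : decision R) : R := (x != y)%:R.

Lemma decision_distxx x : decision_dist x x = 0.
Proof. by rewrite /decision_dist eqxx. Qed.

Lemma decision_dist_eq0 x y : decision_dist x y = 0 -> x = y.
Proof.
rewrite /decision_dist; case: eqP => //= _ /eqP.
by rewrite oner_eq0.
Qed.

Lemma decision_dist_sym x y : decision_dist x y = decision_dist y x.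
Proof. by rewrite /decision_dist eq_sym. Qed.

Lemma decision_dist_triangle y x z :
  decision_dist x z <= decision_dist x y + decision_dist y z.
Proof.
rewrite /decision_dist -natrD ler_nat.
by case: x y z => [] [] [].
Qed.

HB.instance Definition _ := isMetric.Build R (decision R)
  decision_distxx decision_dist_eq0 decision_dist_sym decision_dist_triangle.

End DecisionMetric.

(* Connected undirected graphs on a countably infinite vertex set, with a fixed
   enumeration of the vertices; loops are neither required nor excluded. *)
Record graph := Graph {
  vertex : choiceType;
  venum : nat -> vertex;
  venum_bij : bijective venum;
  adj : rel vertex;
  adj_sym : symmetric adj;
  adj_connected : forall v w, exists2 p, path adj v p & last v p = w
}.

Definition window (R : realType) (J : set R) : Type :=
  {K : set R[i] | exists2 z : R, J z & K = [set z%:C]}.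

Definition qcomplex (R : realType) (q : rat * rat) : R[i] :=
  (ratr q.1) +i* (ratr q.2).

(* From here on the positive integer [n + 1] is represented by [n : nat]: the
   index [n] of [wapprox], [proj_n], [gen_f], [gen_c], of basis vectors and of
   vertices stands for [n + 1], and so does the value [gen_f k = n]. Hence the
   bound 2^-(n + 2) below, the [n.+1] terms of [proj_n] and the [.+1] in the
   value of [gen_f] read by an algorithm. *)
Record window_approx (R : realType) (J : set R) := WindowApprox {
  wapprox :> window J -> nat -> rat * rat;
  wapproxP : forall (K : window J) (z : R[i]) n, sval K = [set z] ->
    normc (qcomplex R (wapprox K n) - z) <= 2 ^- n.+2
}.

Record fset_code (V : choiceType) := FsetCode {
  fcode :> {fset V} -> nat;
  fcode_inj : injective fcode
}.

Section Classes.
Variables (R : realType) (G : graph).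

Inductive rep := Diag | Gen | Graphical.

Definition rep_index (rho : rep) : choiceType :=
  match rho with Diag => nat | Gen => nat | Graphical => vertex G end.

Definition Hsp (rho : rep) : hilbertSpace R := l2_hilbert R (rep_index rho).

Definition proj_n (n : nat) (x : l2_hilbert R nat) : l2_hilbert R nat :=
  \sum_(0 <= i < n.+1) hdot x (l2_basis i) *: l2_basis i.

(* (I - P_m) A P_n *)
Definition off_range (A : operator (l2_hilbert R nat)) (m n : nat)
    (x : l2_hilbert R nat) : l2_hilbert R nat :=
  A (proj_n n x) - proj_n m (A (proj_n n x)).

Record gen_instance := GenInstance {
  gen_op : cdop (l2_hilbert R nat);
  gen_core : core gen_op (lin_span l2_basis);
  gen_core_adj : core (adjoint gen_op) (lin_span l2_basis);
  gen_f : nat -> nat;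
  gen_c : nat -> rat;
  gen_c_ge0 : forall n, 0 <= gen_c n;
  gen_c_null : (ratr (gen_c n) : R) @[n --> \oo] --> (0 : R);
  gen_dispersion : forall n,
    (maxe (opnorm (off_range gen_op (gen_f n) n))
          (opnorm (off_range (adjoint gen_op) (gen_f n) n))
     <= (ratr (gen_c n))%:E)%E
}.

Definition graph_entry (A : operator (l2_hilbert R (vertex G))) (v w : vertex G) : R[i] :=
  hdot (A (l2_basis w)) (l2_basis v).

Record graph_instance := GraphInstance {
  graph_op : cdop (l2_hilbert R (vertex G));
  graph_core : core graph_op (lin_span l2_basis);
  graph_core_adj : core (adjoint graph_op) (lin_span l2_basis);
  graph_S : vertex G -> {fset vertex G};
  graph_S_supp : forall v w, w \notin graph_S v ->
    graph_entry graph_op v w = 0 /\ graph_entry graph_op w v = 0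
}.

Definition Omega (rho : rep) : Type :=
  match rho with
  | Diag => nat -> R[i]
  | Gen => gen_instance
  | Graphical => graph_instance
  end.

Definition op_of (rho : rep) : Omega rho -> cdop (Hsp rho) :=
  match rho with
  | Diag => fun a => diag_cdop a
  | Gen => gen_op
  | Graphical => graph_op
  end.

Variables (J : set R) (r : window_approx J) (code : fset_code (vertex G)).

Definition input (rho : rep) : Type := (Omega rho * window J)%type.

Definition rho_read (rho : rep) (n : nat) (x : input rho) : R[i] := qcomplex R (r x.2 n).

Definition gen_entry (i j : nat) (x : input Gen) : R[i] :=
  hdot (gen_op x.1 (l2_basis j)) (l2_basis i).

Definition rep_read (rho : rep) : set (input rho -> R[i]) :=
  match rho with
  | Diag => range (fun j (x : input Diag) => x.1 j)
  | Gen =>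
      range (fun ij : nat * nat => gen_entry ij.1 ij.2)
      `|` range (fun n (x : input Gen) => (gen_f x.1 n).+1%:R)
      `|` range (fun n (x : input Gen) => ratr (gen_c x.1 n))
  | Graphical =>
      range (fun (ij : nat * nat) (x : input Graphical) =>
        graph_entry (graph_op x.1) (venum G ij.1) (venum G ij.2))
      `|` range (fun i (x : input Graphical) => (code (graph_S x.1 (venum G i)))%:R)
  end.

Definition rep_interface (rho : rep) : set (input rho -> R[i]) :=
  range (@rho_read rho) `|` @rep_read rho.

Lemma window_approx_inj (K K' : window J) : (forall n, r K n = r K' n) -> K = K'.
Proof.
case: K K' => [K hK] [K' hK'] rE.
have [z Jz Kz] := hK; have [z' Jz' Kz'] := hK'.
suff zz' : z = z'.
  by apply: eq_exist; rewrite Kz Kz' zz'.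
apply/eqP; rewrite -subr_eq0; apply/negPn/negP => z0.
have d0 : 0 < `|z - z'| by rewrite normr_gt0.
have bnd n : `|z - z'| <= 2^-1 ^+ n.
  pose q := qcomplex R (r (exist _ K hK) n).
  have h1 : normc (q - z%:C) <= 2 ^- n.+2 by apply: wapproxP.
  have h2 : normc (q - z'%:C) <= 2 ^- n.+2 by rewrite /q rE; apply: wapproxP.
  have -> : `|z - z'| = normc (z - z')%:C by rewrite /= expr0n addr0 sqrtr_sqr.
  have -> : (z - z')%:C = - (q - z%:C) + (q - z'%:C) by rewrite rmorphB /=; ring.
  apply: (le_trans (le_normcD _ _)); rewrite normcN.
  apply: (le_trans (lerD h1 h2)); rewrite exprVn !exprS !invfM.
  have : (0 : R) <= (2 ^+ n)^-1 by rewrite invr_ge0 exprn_ge0.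
  by move: (2 ^+ n)^-1 => t t0; lra.
have := @cvg_expr R 2^-1; rewrite ger0_norm ?invr_ge0// invf_lt1 ?ltr1n// => /(_ isT).
move=> /cvgr0Pnorm_lt /(_ _ d0) [N _ /(_ N (leqnn N))].
by rewrite /= ger0_norm ?exprn_ge0 ?invr_ge0// ltNge bnd.
Qed.

Lemma rep_interface_op (rho : rep) (x y : input rho) :
  (forall l, rep_interface l -> l x = l y) ->
  cd_op (op_of x.1) = cd_op (op_of y.1) /\ x.2 = y.2.
Proof.
move=> xy; split; last first.
  apply: window_approx_inj => n.
  have : qcomplex R (r x.2 n) = qcomplex R (r y.2 n).
    by apply: (xy (rho_read (rho := rho) n)); left; exists n.
  case=> /fmorph_inj h1 /fmorph_inj h2.
  by rewrite [LHS]surjective_pairing h1 h2 -surjective_pairing.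
case: rho x y xy => [] [x K] [y K'] xy /=.
- suff -> : x = y by [].
  apply/funext => j.
  by apply: (xy (fun x : input Diag => x.1 j)); right; exists j.
- apply: operator_basis_ext; [exact: gen_core|exact: gen_core|move=> i j].
  by apply: (xy (@gen_entry i j)); right; left; left; exists (i, j).
- have [nu _ nuK] := venum_bij G.
  apply: operator_basis_ext; [exact: graph_core|exact: graph_core|move=> v w].
  have := xy (fun x : input Graphical => graph_entry (graph_op x.1) v w); apply.
  by right; left; exists (nu v, nu w) => //=; rewrite !nuK.
Qed.

End Classes.

Inductive spectral_set := Spec | PseudoSpec.

Section Ambient.
Variables (R : realType) (G : graph) (J : set R) (eps : R).
Variables (r : window_approx J) (code : fset_code (vertex G)).

Definition spectral_of (s : spectral_set) (H : hilbertSpace R) (A : operator H) :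
    set R[i] :=
  match s with Spec => spectrum A | PseudoSpec => pseudospectrum eps A end.

Definition problem_target (s : spectral_set) (rho : rep) (x : input G J rho) :
    decision R :=
  `[< spectral_of s (op_of x.1) `&` sval x.2 = set0 >].

Lemma problem_separates (s : spectral_set) (rho : rep) (x y : input G J rho) :
  (forall l, rep_interface r code l -> l x = l y) ->
  problem_target s x = problem_target s y.
Proof. by move=> /rep_interface_op[xy1 xy2]; rewrite /problem_target xy1 xy2. Qed.

Definition spectral_problem (s : spectral_set) (rho : rep) : sci_problem R :=
  SCIProblem (@problem_separates s rho).

(* Labels of the six problems of the ambient. *)
Definition ambient : Type := (spectral_set * rep)%type.

Definition ambient_problem (p : ambient) : sci_problem R :=
  spectral_problem p.1 p.2.

Definition le_raw (p q : ambient) : Prop :=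
  exists E : inst (ambient_problem p) -> inst (ambient_problem q), reduces_via E.

Definition encode (rho rho' : rep) (T : Omega R G rho -> Omega R G rho')
    (x : input G J rho) : input G J rho' := (T x.1, x.2).

Definition onb (rho : rep) (n : nat) : Hsp R G rho :=
  match rho with
  | Diag => l2_basis n
  | Gen => l2_basis n
  | Graphical => l2_basis (venum G n)
  end.

Definition real_points : set R[i] := [set t%:C | t in J].

Inductive elementary_form :
    forall rho rho', (Omega R G rho -> Omega R G rho') -> Prop :=
| unitary_conjugacy rho rho' (T : Omega R G rho -> Omega R G rho')
    (U : Hsp R G rho -> Hsp R G rho') :
    unitary U -> (forall a, conjugate_by U (op_of a) (op_of (T a))) ->
    elementary_form T
| basis_relabeling rho rho' (T : Omega R G rho -> Omega R G rho')
    (U : Hsp R G rho -> Hsp R G rho') (s : nat -> nat) :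
    rho <> Graphical -> rho' <> Graphical -> bijective s -> unitary U ->
    (forall n, U (onb rho n) = onb rho' (s n)) ->
    (forall a, conjugate_by U (op_of a) (op_of (T a))) ->
    elementary_form T
| graph_relabeling (T : Omega R G Graphical -> Omega R G Graphical)
    (U : Hsp R G Graphical -> Hsp R G Graphical) (s : vertex G -> vertex G) :
    bijective s -> (forall v w, adj (s v) (s w) = adj v w) -> unitary U ->
    (forall v, U (l2_basis v) = l2_basis (s v)) ->
    (forall a, conjugate_by U (op_of a) (op_of (T a))) ->
    elementary_form T
(* The two inclusions in actual use are [diag_to_gen] and [diag_to_graph]. *)
| representation_inclusion rho rho' (T : Omega R G rho -> Omega R G rho')
    (W : Hsp R G rho -> Hsp R G rho') :
    unitary W -> (forall a, conjugate_by W (op_of a) (op_of (T a))) ->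
    elementary_form T
| neutral_stabilization rho rho' (T : Omega R G rho -> Omega R G rho')
    (H0 : hilbertSpace R) (T0 : cdop H0)
    (W : hsum (Hsp R G rho) H0 -> Hsp R G rho') :
    unitary W -> spectrum T0 `&` real_points = set0 ->
    pseudospectrum eps T0 `&` real_points = set0 ->
    (forall a, conjugate_by W (opsum (op_of a) T0) (op_of (T a))) ->
    elementary_form T.

(* The data on the right determine [T], here and in [diag_to_graph]. *)
Definition diag_to_gen (T : Omega R G Diag -> Omega R G Gen) : Prop :=
  forall a, [/\ conjugate_by id (op_of a) (op_of (T a)),
    gen_f (T a) = id & forall n, gen_c (T a) n = 2 ^- n.+1].

Definition diag_to_graph (T : Omega R G Diag -> Omega R G Graphical) : Prop :=
  exists W : Hsp R G Diag -> Hsp R G Graphical,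
    [/\ unitary W, forall n, W (onb Diag n) = onb Graphical n,
      forall a, conjugate_by W (op_of a) (op_of (T a)) &
      forall a v, graph_S (T a) v = [fset v]%fset].

Definition geometric_structure
    (Enc : forall rho rho', set (input G J rho -> input G J rho')) : Prop :=
  [/\ forall rho rho' e, Enc rho rho' e ->
        exists2 T : Omega R G rho -> Omega R G rho',
          elementary_form T & e = encode T,
      forall T, diag_to_gen T -> Enc Diag Gen (encode T) &
      forall T, diag_to_graph T -> Enc Diag Graphical (encode T)].

Variable Enc : forall rho rho', set (input G J rho -> input G J rho').

Inductive geometric_encoding : forall rho rho', (input G J rho -> input G J rho') -> Prop :=
| geometric_id rho : geometric_encoding (@id (input G J rho))
| geometric_comp rho rho' rho'' (e : input G J rho -> input G J rho')
    (e' : input G J rho' -> input G J rho'') :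
    geometric_encoding e -> Enc e' -> geometric_encoding (e' \o e).

Definition le_geom (p q : ambient) : Prop :=
  exists2 E : input G J p.2 -> input G J q.2,
    geometric_encoding E & @reduces_via R (ambient_problem p) (ambient_problem q) E.

End Ambient.

(* Main.v *)
Require Import Defs.
From mathcomp Require Import all_boot all_order all_algebra finmap.
From mathcomp Require Import all_classical all_reals all_analysis.
From mathcomp Require Import complex ring lra.

Import Order.TTheory GRing.Theory Num.Theory.
Import numFieldNormedType.Exports.
Import ComplexField.Normc.

Local Open Scope classical_set_scope.
Local Open Scope ring_scope.
Local Open Scope complex_scope.

(** For a diagonal operator with entries [a j], both the spectral and the
    pseudospectral target at a point [z] compare one number, the infimum of the
    distances [|a j - z|], with a threshold: [0] for the spectrum and [eps] for
    the pseudospectrum. The target is 1 exactly when the infimum exceeds it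
    ([spectral_of_diag]). Everything about the diagonal problems follows.

    Height. That the infimum exceeds the threshold is an exists-forall statement
    about finitely readable quantities, so two nested limits decide it
    ([diag_has_tower2]). One limit does not: entries are fed to a hypothetical
    sequence of algorithms in blocks, each block constant and staying a little
    above the threshold, until an algorithm of large index answers 1 on the
    basis of finitely many entries; then a block closer to the threshold is
    started. On the resulting sequence the answer is 1 infinitely often while
    the target is 0 ([diag_no_tower1]).

    Raw reductions. Moving every distance by the difference of the two
    thresholds turns one target into the other. The exact point [z] is not
    readable, but the distances [|a j - z|] may be replaced by the family of
    their upper bounds computed from the rational approximations of [z], which
    has the same infimum ([le_raw_diag]). Hence the two diagonal problems have
    the same raw degree.

    Geometric reductions. Spectrum and pseudospectrum are both determined by the
    pairs [(z, M)] for which [A - z] is onto and [|x| <= M |(A - z) x|]. This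
    relation is invariant under unitary conjugation, and for a direct sum it is
    the conjunction over the summands; so on the points of [J] an elementary
    encoding changes neither target ([encode_target]). A geometric reduction
    would thus make one diagonal target a function of the other, which diagonals
    at distance [0], [eps / 2] and [2 eps] from [z] rule out
    ([le_geom_diag_antichain]).

    In both preorders every problem lies above the diagonal problem for the same
    spectral set, by the inclusion encodings. So the diagonal problems carry all
    the minimal degrees: one when they are equivalent, two when they are
    incomparable ([MinDeg2_card]). *)

(** * Resolvent bounds *)

Section ResolventBound.
Context {R : realType} {H : hilbertSpace R}.
Implicit Types (A : operator H) (x y : H) (z : R[i]).

Lemma normc_ge0 z : 0 <= normc z.
Proof. by case: z => a b; exact: sqrtr_ge0. Qed.

Lemma hnormZ (c : R[i]) x : hnorm (c *: x) = normc c * hnorm x.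
Proof.
rewrite {1}/hnorm /dot_norm hdotZl hdotZr -hnorm_sqE.
have -> : complex.Re (c * (conjc c * (hnorm x ^+ 2)%:C)) = (normc c * hnorm x) ^+ 2.
  by rewrite exprMn normc_sq; case: c => a b; simpc => /=; ring.
by rewrite sqrtr_sqr ger0_norm// mulr_ge0 ?hnorm_ge0 ?normc_ge0.
Qed.

Lemma hnorm0 : hnorm (0 : H) = 0.
Proof. by rewrite -(scale0r 0) hnormZ normc0 mul0r. Qed.

(** A form of [resolvent_norm A z <= M] that mentions neither the inverse nor
    suprema, and therefore passes easily through conjugations and sums. *)
Definition resolvent_bound A z (M : R) : Prop :=
  (forall y, exists2 x, dom A x & A x - z *: x = y) /\
  (forall x, dom A x -> hnorm x <= M * hnorm (A x - z *: x)).

Lemma app_shift_lin A z (c : R[i]) x y : dom A x -> dom A y ->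
  A (c *: x + y) - z *: (c *: x + y) = c *: (A x - z *: x) + (A y - z *: y).
Proof.
move=> dx dy; rewrite app_lin// scalerDr scalerBr !scalerA [z * c]mulrC opprD.
by rewrite addrACA.
Qed.

(** The bound on the unit ball extends to all vectors by rescaling; conversely
    the lower bound on [A - z] makes it injective, hence bijective. *)
Lemma resolvent_norm_le A z (M : R) : 0 <= M ->
  (resolvent_norm A z <= M%:E)%E <-> resolvent_bound A z M.
Proof.
move=> M0; split.
  rewrite /resolvent_norm; case: ifPn => [_|/asboolPn /contrapT].
    by rewrite leye_eq.
  move=> [[_ inj srj] _] hM; split => [y|x dx].
    by have [x dx <-] := srj y I; exists x.
  set y := A x - z *: x.
  have [y0|y0] := eqVneq (hnorm y) 0.
    have /hnorm_eq0 ye := y0.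
    suff -> : x = 0 by rewrite hnorm0 mulr_ge0 ?hnorm_ge0.
    apply: inj; rewrite ?inE//; first exact: dom0.
    by rewrite -/y ye app0 scaler0 subrr.
  have ypos : 0 < hnorm y by rewrite lt_neqAle eq_sym y0 hnorm_ge0.
  pose c : R[i] := ((hnorm y)^-1)%:C.
  have nc : normc c = (hnorm y)^-1.
    by rewrite /c /= expr0n addr0 sqrtr_sqr ger0_norm// invr_ge0 hnorm_ge0.
  have dcx : dom A (c *: x) by exact: dom_lin0.
  have cxE : A (c *: x) - z *: (c *: x) = c *: y.
    have := app_shift_lin A z c x 0 dx (dom0 A).
    by rewrite app0 scaler0 subrr !addr0.
  have resE : resolvent A z (c *: y) = c *: x.
    rewrite /resolvent; case: xgetP => [w _ [dw wE]|/(_ (c *: x))[]//].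
    by apply: inj; rewrite ?inE// wE cxE.
  have : (hnorm (c *: x) <= M).
    rewrite -lee_fin; apply: le_trans hM.
    apply: ereal_sup_ubound; exists (c *: y); last by rewrite resE.
    by rewrite /= hnormZ nc mulVf.
  by rewrite hnormZ nc mulrC ler_pdivrMr.
move=> [srj bnd].
have inj x y : dom A x -> dom A y -> A x - z *: x = A y - z *: y -> x = y.
  move=> dx dy xy; apply/eqP; rewrite -subr_eq0; apply/eqP/hnorm_eq0/eqP.
  rewrite eq_le hnorm_ge0 andbT.
  have -> : x - y = (-1) *: y + x by rewrite scaleN1r addrC.
  apply: (le_trans (bnd _ (dom_lin (-1) dy dx))).
  by rewrite app_shift_lin// xy scaleN1r addNr hnorm0 mulr0.
have op : (opnorm (resolvent A z) <= M%:E)%E.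
  apply: ge_ereal_sup => _ [y /= y1 <-]; rewrite lee_fin /resolvent.
  case: xgetP => [x _ [dx xE]|_]; last by rewrite hnorm0.
  by apply: (le_trans (bnd _ dx)); rewrite xE ler_piMr.
rewrite /resolvent_norm asboolF//; apply; split; last first.
  by apply: le_lt_trans op _; rewrite ltry.
split=> //.
- by move=> x y; rewrite !inE; exact: inj.
- by move=> y _; have [x dx <-] := srj y; exists x.
Qed.

Lemma spectrumP A z :
  spectrum A z <-> ~ exists2 M, 0 <= M & resolvent_bound A z M.
Proof.
split=> [sz [M M0 /(resolvent_norm_le A z M M0)]|].
  by rewrite /resolvent_norm asboolT// leye_eq.
apply: contra_notP => /contrapT rz.
have fo : opnorm (resolvent A z) \is a fin_num.
  have o0 : (0 <= opnorm (resolvent A z))%E.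
    apply: (@le_trans _ _ (hnorm (resolvent A z 0))%:E).
      by rewrite lee_fin hnorm_ge0.
    by apply: ereal_sup_ubound; exists 0 => //=; rewrite hnorm0 ler01.
  by rewrite ge0_fin_numE//; case: rz.
have o0 : 0 <= fine (opnorm (resolvent A z)).
  rewrite -lee_fin fineK//; apply: (@le_trans _ _ (hnorm (resolvent A z 0))%:E).
    by rewrite lee_fin hnorm_ge0.
  by apply: ereal_sup_ubound; exists 0 => //=; rewrite hnorm0 ler01.
exists (fine (opnorm (resolvent A z))) => //.
apply/resolvent_norm_le => //.
by rewrite /resolvent_norm asboolF ?fineK//; apply.
Qed.

Lemma pseudospectrumE (eps : R) A : 0 < eps ->
  pseudospectrum eps A =
  closure (~` [set z | resolvent_bound A z eps^-1] : set R[i]^o).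
Proof.
move=> e0; have i0 : 0 <= eps^-1 by rewrite invr_ge0 ltW.
rewrite /pseudospectrum; apply: congr1; apply/seteqP; split=> z /=.
  by rewrite ltNge => /negP h /resolvent_norm_le => /(_ i0).
by move=> h; rewrite ltNge; apply/negP => /resolvent_norm_le => /(_ i0).
Qed.

End ResolventBound.

(** Only the relation [resolvent_bound] enters in the two spectral sets, so
    operators on different spaces can be compared through it. *)
Lemma eq_spectral_of (R : realType) (eps : R) (s : spectral_set)
    (H1 H2 : hilbertSpace R) (A : operator H1) (B : operator H2) : 0 < eps ->
  (forall z M, 0 <= M -> resolvent_bound A z M <-> resolvent_bound B z M) ->
  spectral_of eps s A = spectral_of eps s B.
Proof.
move=> e0 AB; case: s => /=.
  apply/seteqP; split=> z; rewrite !spectrumP; apply: contra_not => -[M M0 h];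
    by exists M => //; apply/AB.
rewrite !pseudospectrumE//; apply: congr1; apply/seteqP.
by split=> z /=; apply: contra_not => h; apply/AB => //; rewrite invr_ge0 ltW.
Qed.

Section Conjugation.
Context {R : realType} {H1 H2 : hilbertSpace R}.

Lemma unitary_hnorm (U : H1 -> H2) x : unitary U -> hnorm (U x) = hnorm x.
Proof. by move=> [_ dU _]; rewrite /hnorm /dot_norm dU. Qed.

Lemma unitary_shift (U : H1 -> H2) (A : operator H1) (B : operator H2) z x :
  unitary U -> conjugate_by U A B -> dom A x ->
  B (U x) - z *: U x = U (A x - z *: x).
Proof.
move=> [lU _ _] [_ BU] dx.
by rewrite BU// -scaleNr addrC -lU scaleNr addrC.
Qed.

Lemma resolvent_bound_conj (U : H1 -> H2) (A : operator H1) (B : operator H2) z M :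
  unitary U -> conjugate_by U A B ->
  resolvent_bound A z M <-> resolvent_bound B z M.
Proof.
move=> uU cU; have [lU dU sU] := uU; have [dB BU] := cU.
have dBU x : dom A x -> dom B (U x) by rewrite dB => dx; exists x.
split=> -[srj bnd]; split.
- move=> y; have [y' <-] := sU y; have [x dx <-] := srj y'.
  by exists (U x); [exact: dBU|rewrite (unitary_shift U A B)].
- rewrite dB => _ [x dx <-]; rewrite (unitary_shift U A B)// !unitary_hnorm//.
  exact: bnd.
- move=> y; have := srj (U y); rewrite dB => -[_ [x dx <-]].
  rewrite (unitary_shift U A B)// => /(congr1 (fun v => v - U y)).
  rewrite subrr => h; exists x => //; apply/eqP; rewrite -subr_eq0; apply/eqP.
  apply: hnorm_eq0; rewrite -(unitary_hnorm U)//.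
  have -> : U (A x - z *: x - y) = U (A x - z *: x) - U y.
    by rewrite [A x - _ - y]addrC -scaleN1r lU scaleN1r addrC.
  by rewrite h hnorm0.
- move=> x dx; have := bnd _ (dBU _ dx).
  by rewrite (unitary_shift U A B)// !unitary_hnorm.
Qed.

(** Restricting to vectors [(x, 0)] and [(0, x)] gives one direction; for the
    other, the squared bounds of the summands add up. *)
Lemma resolvent_bound_sum (A : operator H1) (B : operator H2) z M : 0 <= M ->
  resolvent_bound (opsum A B) z M <-> resolvent_bound A z M /\ resolvent_bound B z M.
Proof.
move=> M0.
have appE (x : hsum H1 H2) : dom A x.1 -> dom B x.2 ->
    opsum A B x - z *: x = (A x.1 - z *: x.1, B x.2 - z *: x.2).
  by move=> dx1 dx2; rewrite /= /opsum_app asboolT.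
have nE (x : hsum H1 H2) : hnorm x ^+ 2 = hnorm x.1 ^+ 2 + hnorm x.2 ^+ 2.
  exact: hsum_norm_sq.
split=> [[srj bnd]|[[srjA bndA] [srjB bndB]]].
  split; split.
  - move=> y; have [[x1 x2] [/= d1 d2]] := srj (y, 0).
    by rewrite appE//= => -[h _]; exists x1.
  - move=> x dx; have := bnd (x, 0) (conj dx (dom0 B)).
    rewrite appE//=; last exact: dom0.
    rewrite app0 scaler0 subrr -ler_sqr ?nnegrE ?mulr_ge0 ?hnorm_ge0//.
    rewrite exprMn !nE /= hnorm0 expr0n !addr0 -exprMn.
    by rewrite ler_sqr ?nnegrE ?mulr_ge0 ?hnorm_ge0.
  - move=> y; have [[x1 x2] [/= d1 d2]] := srj (0, y).
    by rewrite appE//= => -[_ h]; exists x2.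
  - move=> x dx; have := bnd (0, x) (conj (dom0 A) dx).
    rewrite appE//=; last exact: dom0.
    rewrite app0 scaler0 subrr -ler_sqr ?nnegrE ?mulr_ge0 ?hnorm_ge0//.
    rewrite exprMn !nE /= hnorm0 expr0n !add0r -exprMn.
    by rewrite ler_sqr ?nnegrE ?mulr_ge0 ?hnorm_ge0.
split.
  move=> [y1 y2]; have [x1 d1 <-] := srjA y1; have [x2 d2 <-] := srjB y2.
  by exists (x1, x2) => //; rewrite appE.
move=> x [d1 d2]; rewrite appE// -ler_sqr ?nnegrE ?mulr_ge0 ?hnorm_ge0//.
rewrite exprMn !nE /= mulrDr -!exprMn lerD// ler_sqr ?nnegrE ?mulr_ge0 ?hnorm_ge0//.
  exact: bndA.
exact: bndB.
Qed.

End Conjugation.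

Lemma normc_real {R : realType} (x : R) : 0 <= x -> normc (x%:C) = x.
Proof. by move=> x0; rewrite /= expr0n addr0 sqrtr_sqr ger0_norm. Qed.

(** * Spectrum and pseudospectrum of a diagonal operator *)

Section DiagonalSpectrum.
Context {R : realType} {I : choiceType}.
Local Notation H := (l2_hilbert R I).
Local Notation coord x i := ((x : l2 R I) i).

Lemma le_hnorm (M : R) (x y : H) : 0 <= M ->
  (forall i, normc (coord x i) <= M * normc (coord y i)) ->
  hnorm x <= M * hnorm y.
Proof.
move=> M0 xy.
have nM := normc_real _ M0.
rewrite -nM -hnormZ -ler_sqr ?nnegrE ?hnorm_ge0// !hnorm_l2_sq.
apply: fine_le; try by apply: esumr_fin (l2P _) => i; exact: sqr_ge0.
apply: le_esumr => i; rewrite ler_sqr ?nnegrE ?normc_ge0//.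
by apply: le_trans (xy i) _; rewrite -{1}nM -normcM.
Qed.

Lemma hnorm_basis (i : I) : hnorm (l2_basis i : H) = 1.
Proof.
apply/eqP; rewrite -sqrp_eq1 ?hnorm_ge0//; apply/eqP.
have /(congr1 (@complex.Re R)) := hnorm_sqE (l2_basis i : H).
by rewrite hdot_basis /= eqxx.
Qed.

Lemma diag_dom_basis (a : I -> R[i]) j : dom (diag_op a) (l2_basis j).
Proof.
rewrite /= /diag_dom /= /square_summable.
apply: (@esumr_fset_lt _ _ _ [fset j]%fset) => i; first exact: sqr_ge0.
by rewrite inE => /negPf /= ->; rewrite mulr0 normc0 expr0n.
Qed.

Lemma diag_basis (a : I -> R[i]) j :
  diag_op a (l2_basis j) = a j *: (l2_basis j : H).
Proof.
apply: l2_ext => i; rewrite /= diag_appE; last exact: diag_dom_basis.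
rewrite -[LHS]/(a i * (i == j)%:R) -[RHS]/(a j * (i == j)%:R).
by case: eqVneq => [->//|_]; rewrite !mulr0.
Qed.

(** Basis vectors are eigenvectors, which makes the condition necessary; when it
    holds, dividing coordinatewise by [a j - z] stays in l2 and inverts. *)
Lemma resolvent_bound_diag (a : I -> R[i]) z (M : R) : 0 <= M ->
  resolvent_bound (diag_op a) z M <-> forall j, 1 <= M * normc (a j - z).
Proof.
move=> M0; split=> [[_ bnd] j|az].
  have := bnd _ (diag_dom_basis a j).
  by rewrite diag_basis -scalerBl hnormZ hnorm_basis mulr1.
have az0 j : a j - z != 0.
  by apply/eqP => h; have := az j; rewrite h normc0 mulr0 ler10.
have shiftE (x : H) j : dom (diag_op a) x ->
    coord (diag_op a x - z *: x) j = (a j - z) * coord x j.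
  move=> dx; rewrite l2_subE [coord (diag_op a x) j]diag_appE// mulrBl.
  by congr (_ - _).
split=> [y|x dx].
  have sx : square_summable (fun j => (a j - z)^-1 * coord y j).
    apply: (@esumr_lt _ _ _ (fun j => normc (M%:C * coord y j) ^+ 2)).
      move=> j; rewrite ler_sqr ?nnegrE ?normc_ge0// !normcM normcV.
      rewrite ler_wpM2r ?normc_ge0//= expr0n addr0 sqrtr_sqr ger0_norm//.
      rewrite -div1r ler_pdivrMr//.
      by rewrite lt_neqAle normc_ge0 andbT eq_sym; apply: contraNneq (az0 j) => /eq0_normc ->.
    exact/square_summableZ/l2P.
  have lx : (fun j => (a j - z)^-1 * coord y j) \in @l2_pred R I by exact/asboolP.
  have dx : dom (diag_op a) (L2 lx : H).
    have -> : dom (diag_op a) (L2 lx : H) =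
        square_summable (fun j => z * coord (L2 lx : H) j + coord y j).
      rewrite /= /diag_dom /=; congr square_summable; apply/funext => j /=.
      by have := az0 j => az0j; field.
    by apply: square_summableD (l2P _); exact/square_summableZ/l2P.
  exists (L2 lx : H) => //; apply: l2_ext => j; rewrite shiftE//=.
  by rewrite mulrA mulfV// mul1r.
apply: le_hnorm => // j; rewrite shiftE// normcM mulrA.
by rewrite ler_peMl ?normc_ge0.
Qed.

End DiagonalSpectrum.

Section DiagonalTarget.
Context {R : realType} {I : choiceType}.
Variable eps : R.
Hypothesis eps_gt0 : 0 < eps.

Definition threshold (s : spectral_set) : R :=
  match s with Spec => 0 | PseudoSpec => eps end.

Lemma threshold_ge0 s : 0 <= threshold s.
Proof. by case: s => //=; exact: ltW. Qed.

Lemma closure_normcP (S : set R[i]) (z : R[i]) :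
  closure (S : set R[i]^o) z <->
  forall d : R, 0 < d -> exists2 w, S w & normc (z - w) < d.
Proof.
have normE (w : R[i]) : `|w : R[i]^o| = (normc w)%:C by [].
split=> [cz d d0|h B].
  have dC0 : (0 : R[i]) < d%:C by rewrite ltcR.
  have [w [Sw]] := cz _ (nbhsx_ballx (z : R[i]^o) _ dC0).
  by rewrite -ball_normE /= normE ltcR => zw; exists w.
move=> /nbhs_ballP[e /= e0 eB]; have eE : e = (complex.Re e)%:C.
  by move: e0; rewrite ltcE /= => /andP[/eqP h0 _]; case: (e) h0 => a b /= ->.
have [w Sw zw] := h (complex.Re e) ltac:(by move: e0; rewrite ltcE => /andP[]).
by exists w; split=> //; apply: eB; rewrite -ball_normE /= normE eE ltcR.
Qed.

(** For the pseudospectrum the set [inf |a j - z| < eps] has to be closed up: a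
    point at distance less than [eps + d / 2] of some [a j] is within [d] of one
    at distance less than [eps], found on the segment to [a j]. *)
Lemma spectral_of_diag s (a : I -> R[i]) z :
  spectral_of eps s (diag_op a) z <->
  ~ exists2 d : R, 0 < d & forall j, threshold s + d <= normc (a j - z).
Proof.
case: s => /=.
  rewrite spectrumP; split; apply: contra_not.
    move=> [d d0 hd]; exists d^-1; first by rewrite invr_ge0 ltW.
    apply/resolvent_bound_diag; first by rewrite invr_ge0 ltW.
    by move=> j; rewrite ler_pdivlMl// mulr1; have := hd j; rewrite add0r.
  move=> [M M0 /(resolvent_bound_diag _ _ _ M0) h].
  exists (M + 1)^-1 => [|j]; first by rewrite invr_gt0; lra.
  rewrite add0r -div1r ler_pdivrMr; last by lra.
  by have := h j; have := normc_ge0 (a j - z); nra.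
have i0 : 0 <= eps^-1 by rewrite invr_ge0 ltW.
have inP w : ~ resolvent_bound (diag_op a) w eps^-1 <-> exists j, normc (a j - w) < eps.
  split=> [|[j jw] /(resolvent_bound_diag _ _ _ i0)/(_ j)].
    apply: contra_notP => /forallNP h; apply/resolvent_bound_diag => // j.
    by rewrite ler_pdivlMl// mulr1 leNgt; apply/negP/h.
  by rewrite ler_pdivlMl// mulr1 leNgt jw.
rewrite pseudospectrumE// closure_normcP; split=> [h [d d0 hd]|h d d0].
  have [w /inP[j jw] zw] := h d d0.
  have := hd j; have -> : a j - z = (a j - w) - (z - w) by ring.
  have := le_normcD (a j - w) (- (z - w)); rewrite normcN; lra.
have [j jz] : exists j, normc (a j - z) < eps + d / 2.
  apply: contrapT => /forallNP hn; apply: h; exists (d / 2); first by rewrite divr_gt0.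
  by move=> j; rewrite leNgt; apply/negP/hn.
have d2 : 0 < d / 2 by rewrite divr_gt0.
have q0 : 0 < eps + d / 2 by rewrite addr_gt0.
(* The point dividing the segment from [z] to [a j] in the ratio [d / 2 : eps]. *)
pose t := (d / 2) / (eps + d / 2); exists (z + t%:C * (a j - z)).
  apply/inP; exists j.
  have -> : a j - (z + t%:C * (a j - z)) = (eps / (eps + d / 2))%:C * (a j - z).
    have -> : eps / (eps + d / 2) = 1 - t.
      by rewrite /t -[X in X - _](mulfV (lt0r_neq0 q0)) -mulrBl addrK.
    by rewrite rmorphB /= mulrBl mul1r opprD addrA.
  rewrite normcM normc_real ?divr_ge0 ?ltW//.
  by rewrite mulrAC ltr_pdivrMr// ltr_pM2l.
have -> : z - (z + t%:C * (a j - z)) = - (t%:C * (a j - z)) by ring.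
rewrite normcN normcM normc_real ?divr_ge0 ?ltW//.
rewrite /t mulrAC ltr_pdivrMr// ltr_pM ?normc_ge0 ?ltW//.
by rewrite ltr_pdivrMr// ltr_pMr// ltr1n.
Qed.
End DiagonalTarget.

(** * Reductions and minimal degrees *)

Section Reductions.
Context {R : realType}.
Implicit Types S P Q : sci_problem R.

(** The requirement that a reduction puts on each function of the target
    interface, without explicit indexing or combining map, so that finitely many
    finite reading sets can simply be united when reductions are composed. *)
Definition finitely_read S (f : inst S -> R[i]) : Prop :=
  exists F : set (inst S -> R[i]), [/\ finite_set F, F `<=` interface S &
    forall x y, (forall g, F g -> g x = g y) -> f x = f y].

Lemma finitely_readP S (f : inst S -> R[i]) : finitely_read S f <->
  exists (m : nat) (g : 'I_m -> inst S -> R[i]) (theta : ('I_m -> R[i]) -> R[i]),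
    (forall i, interface S (g i)) /\ (forall x, f x = theta (fun i => g i x)).
Proof.
split=> [[F [[m]]]|[m [g [theta [Sg fE]]]]].
  move=> /card_set_bijP[f0 [f0F injf0 sf0]] FS dF.
  have /choice[g gP] : forall i : 'I_m, exists h, F h /\ f0 h = i.
    by move=> i; have [h Fh hi] := sf0 i (ltn_ord i); exists h.
  have gF h : F h -> exists i, g i = h.
    move=> Fh; exists (Ordinal (f0F _ Fh)); have [Fg /= ghE] := gP (Ordinal (f0F _ Fh)).
    by apply: injf0; rewrite ?inE.
  exists m, (fun i => g i), (fun v => xget 0
    [set c | exists x, (forall i : 'I_m, g i x = v i) /\ f x = c]).
  split=> [i|x]; first by have [/FS] := gP i.
  case: xgetP => [_ _ [y [yx <-]]|/(_ (f x))[]]; last by exists x.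
  by apply: dF => h /gF[i <-]; rewrite yx.
exists (range g); split=> [|_ [i _ <-]//|x y xy].
- exact/finite_image/finite_finset.
- by rewrite !fE; congr theta; apply/funext => i; apply: xy; exists i.
Qed.

Lemma finitely_read_cst S (c : R[i]) : finitely_read S (fun=> c).
Proof. by exists set0; split=> //; exact: finite_set0. Qed.

Lemma finitely_read1 S (f g : inst S -> R[i]) : interface S g ->
  (forall x y, g x = g y -> f x = f y) -> finitely_read S f.
Proof.
move=> Sg fg; exists [set g]; split=> [|_ ->//|x y /(_ g erefl)/fg//].
exact: finite_set1.
Qed.

Lemma finitely_read2 S (f g1 g2 : inst S -> R[i]) :
  interface S g1 -> interface S g2 ->
  (forall x y, g1 x = g1 y -> g2 x = g2 y -> f x = f y) -> finitely_read S f.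
Proof.
move=> S1 S2 fg; exists [set g1; g2]; split.
- exact: finite_set2.
- by move=> _ [] ->.
- by move=> x y xy; apply: fg; apply: xy; [left|right].
Qed.

Lemma reduces_via_intro S P (E : inst S -> inst P) (D : out P -> out S) :
  continuous D -> (forall x, D (target P (E x)) = target S x) ->
  (forall l, interface P l -> finitely_read S (l \o E)) -> reduces_via E.
Proof.
move=> cD DE El; split; first by exists D.
by move=> l /El/finitely_readP.
Qed.

Lemma reduces_via_id P : @reduces_via R P P id.
Proof.
apply: (@reduces_via_intro P P id id) => [x|//|l Pl]; first exact: cvg_id.
exact: (@finitely_read1 P (l \o id) l Pl (fun x y h => h)).
Qed.

Lemma reduces_via_comp S P Q (E : inst S -> inst P) (E' : inst P -> inst Q) :
  reduces_via E -> reduces_via E' -> @reduces_via R S Q (E' \o E).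
Proof.
move=> [[D cD DE] El] [[D' cD' DE'] El'].
apply: (@reduces_via_intro S Q _ (D \o D')) => [x|x|l /El'/finitely_readP].
- exact: continuous_comp (cD' x) (cD (D' x)).
- by rewrite /= DE' DE.
- move=> [F [finF FP lF]].
  have /choice[G hG] : forall g, exists G : set (inst S -> R[i]), F g ->
      [/\ finite_set G, G `<=` interface S &
        forall x y, (forall h, G h -> h x = h y) -> g (E x) = g (E y)].
    move=> g; have [Fg|nFg] := pselect (F g); last by exists set0.
    by have /finitely_readP[G hG] := El _ (FP _ Fg); exists G.
  exists (\bigcup_(g in F) G g); split.
  + by apply: bigcup_finite => // g /hG[].
  + by move=> h [g /hG[_ GS _]]; exact: GS.
  + move=> x y xy; apply: lF => g Fg; have [_ _] := hG _ Fg; apply => h Gh.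
    by apply: xy; exists g.
Qed.

End Reductions.

Section MinimalDegreesOfBasis.
Context {R : realType} {T : Type} {problem : T -> sci_problem R}.
Variable le : T -> T -> Prop.
Hypothesis refl_le : forall p, le p p.
Hypothesis trans_le : forall {p q t}, le p q -> le q t -> le p t.

Local Notation level2 := (level2 problem).
Local Notation degree := (degree problem le).

Lemma degree_mem p : level2 p -> degree p p.
Proof. by split. Qed.

Lemma eq_degree p q : le p q -> le q p -> degree p = degree q.
Proof.
move=> pq qp; apply/seteqP; split=> t [lt h1 h2]; split=> //.
- exact: trans_le qp h1.
- exact: trans_le h2 pq.
- exact: trans_le pq h1.
- exact: trans_le h2 qp.
Qed.

Lemma degree_leP p q : level2 p -> level2 q ->
  degree_le le (degree p) (degree q) <-> le p q.
Proof.
move=> lp lq; split=> [[p' [q' [[_ pp' _] [_ _ q'q] p'q']]]|pq].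
  exact: trans_le (trans_le pp' p'q') q'q.
by exists p, q; split=> //; exact: degree_mem.
Qed.

Lemma degree_eqP p q : level2 p -> degree p = degree q -> le q p.
Proof. by move=> lp pq; have := degree_mem _ lp; rewrite pq => -[]. Qed.

Variables (n : nat) (b : nat -> T).
Hypothesis b_level2 : forall k, (k < n)%N -> level2 (b k).
Hypothesis b_below : forall q, level2 q -> exists2 k, (k < n)%N & le (b k) q.
Hypothesis b_antichain : forall j k, (j < n)%N -> (k < n)%N -> le (b j) (b k) -> j = k.

(** A minimal degree lies above some [degree (b k)], hence equals it. A degree
    below [degree (b k)] lies in turn above some [degree (b j)], so [j = k] and it
    is [degree (b k)] itself. *)
Lemma MinDeg2_basis : MinDeg2 problem le = (degree \o b) @` `I_n.
Proof.
apply/seteqP; split=> C.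
  move=> [[q lq <-] minq]; have [k kn bq] := b_below _ lq.
  exists k => //=; apply: minq; first by exists (b k) => //; exact: b_level2.
  by apply/degree_leP => //; exact: b_level2.
move=> [k kn <-] /=; have lk := b_level2 _ kn.
split; first by exists (b k).
move=> _ [q lq <-] /degree_leP => /(_ lq lk) qk.
have [j jn jq] := b_below _ lq.
have jk := b_antichain _ _ jn kn (trans_le jq qk).
by rewrite jk in jq; exact: eq_degree.
Qed.

Lemma MinDeg2_card : (MinDeg2 problem le #= `I_n)%card.
Proof.
rewrite MinDeg2_basis; apply: inj_card_eq => j k; rewrite !inE => jn kn /=.
by move=> jk; apply/esym/b_antichain => //; apply: degree_eqP => //; exact: b_level2.
Qed.

Lemma principal_card :
  principal problem le <-> (MinDeg2 problem le #= `I_1)%card.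
Proof.
split=> [[C [mC uC]]|].
  have -> : MinDeg2 problem le = [set C].
    by apply/seteqP; split=> [D /uC|_ ->].
  exact/card_set1.
move=> /card_esym/card_set_bijP[f [fM _ Mf]]; exists (f 0%N); split; first exact: fM.
by move=> D /Mf[[|//] _ <-].
Qed.

Lemma principal_basis : principal problem le <-> n = 1%N.
Proof.
rewrite principal_card; split=> [|<-]; last exact: MinDeg2_card.
by move=> /card_esym/card_eq_trans/(_ MinDeg2_card)/card_eq_II ->.
Qed.

End MinimalDegreesOfBasis.

(** * Diagonal problems have height 2 *)

Lemma le_of_le_add_exp2 {R : realType} (x y : R) :
  (forall n, x <= y + 2 ^- n) -> x <= y.
Proof.
move=> xy; apply/ler_addgt0Pr => e e0.
have [N _ /(_ N (leqnn N))] := near_infty_natSinv_expn_lt (PosNum e0).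
by rewrite /= div1r => /ltW h; apply: le_trans (xy N) _; rewrite lerD2l.
Qed.

Section Towers.
Context {R : realType}.
Implicit Types P : sci_problem R.

Lemma decision_cvgP (v : nat -> decision R) (l : decision R) :
  v n @[n --> \oo] --> l <-> exists N, forall n, (N <= n)%N -> v n = l.
Proof.
split=> [/metricType_numDomainType.cvgrPdist_lt/(_ 1 ltr01)[N _ hN]|[N hN]].
  exists N => n /hN /=; rewrite /mdist /= /decision_dist.
  by case: eqP => //; rewrite ltxx.
apply/metricType_numDomainType.cvgrPdist_lt => e e0; exists N => // n /= /hN ->.
by rewrite mdistxx.
Qed.

Lemma has_tower_succ0 P : has_tower P 0 -> has_tower P 1.
Proof.
move=> [Gam hG]; exists (fun=> Gam [tuple]) => x /=.
exists (fun=> Gam [tuple] x) => //.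
by have /= -> := hG x; exact: cvg_cst.
Qed.

(** A tower of height 0 gives one of height 1, constant in its index, so that
    excluding height 1 suffices. *)
Lemma SCI_G_eq2 P : has_tower P 2 -> ~ has_tower P 1 -> SCI_G P = Some 2.
Proof.
move=> h2 h1; rewrite /SCI_G; case: pselect => [h|[]]; last first.
  by exists 2; exact/asboolP.
congr Some; case: ex_minnP => -[|[|k]] /asboolP hk mk.
- by have := has_tower_succ0 _ hk.
- by [].
- by apply/eqP; rewrite eqn_leq mk//; exact/asboolP.
Qed.

Definition fixed_read_algorithm P (F : set (inst P -> R[i])) (f : inst P -> out P)
    (FP : F `<=` interface P) (finF : finite_set F)
    (fF : forall x y, (forall l, F l -> l y = l x) -> f y = f x) :
  general_algorithm P :=
  @GeneralAlgorithm R P f (fun=> F) (fun=> FP) (fun=> finF)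
    (fun x y h => conj (fF x y h) erefl).

End Towers.

Section DiagonalHeight.
Context {R : realType} {G : graph} {J : set R} {eps : R}.
Variables (r : window_approx J) (code : fset_code (vertex G)).
Hypothesis eps_gt0 : 0 < eps.
Local Notation input := (input (R := R) G J Diag).
Local Notation problem s := (spectral_problem eps r code s Diag).
Local Notation threshold := (threshold eps).

Definition window_pt (t : R) (Jt : J t) : window J :=
  exist _ [set t%:C] (ex_intro2 _ _ t Jt erefl).

Lemma problem_target_diag s (x : input) (z : R[i]) : sval x.2 = [set z] ->
  problem_target eps s x = true <->
  exists2 d : R, 0 < d & forall j, threshold s + d <= normc (x.1 j - z).
Proof.
move=> xz; have spE := @spectral_of_diag R nat eps eps_gt0 s x.1 z.
rewrite /problem_target xz; split=> [/asboolP h|h].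
  by apply: contrapT => /spE sz; have : set0 z by rewrite -h.
apply/asboolP; apply/seteqP; split=> // w [sw /= wz]; move: sw; rewrite wz.
by move=> /spE.
Qed.

(** An upper bound of [|a i - z|] that depends on one entry and one rational
    approximation of [z], and tends to [|a i - z|] as [n] grows. *)
Definition margin (x : input) (i n : nat) : R :=
  normc (x.1 i - qcomplex R (r x.2 n)) + 2 ^- n.+2.

Lemma problem_target_margin s (x : input) :
  problem_target eps s x = true <->
  exists2 d : R, 0 < d & forall i n, threshold s + d <= margin x i n.
Proof.
have [z _ xz] := svalP x.2; rewrite (problem_target_diag s x _ xz).
have tri i n : normc (x.1 i - z%:C) <= margin x i n /\
    margin x i n <= normc (x.1 i - z%:C) + 2 ^- n.+1.
  have := wapproxP r n xz; rewrite /margin; set q := qcomplex _ _ => qz.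
  have h1 := le_normcD (x.1 i - q) (q - z%:C).
  have h2 := le_normcD (x.1 i - z%:C) (- (q - z%:C)).
  rewrite subrKA in h1; rewrite normcN opprB subrKA in h2.
  have -> : 2 ^- n.+1 = 2 ^- n.+2 + 2 ^- n.+2 :> R.
    by rewrite !exprS !invfM; lra.
  split; first by apply: le_trans h1 _; rewrite lerD2l.
  by rewrite addrA lerD2r; apply: le_trans h2 _; rewrite lerD2l.
split=> -[d d0 hd]; exists d => //; [move=> i n|move=> i].
  by apply: le_trans (hd i) _; case: (tri i n).
apply: le_of_le_add_exp2 => n; apply: le_trans (hd i n) _.
apply: le_trans (tri i n).2 _; rewrite lerD2l.
by rewrite lef_pV2 ?posrE ?exprn_gt0// ler_eXn2l// ltr1n.
Qed.

Definition mu_read (j : nat) (x : input) : R[i] := x.1 j.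

Lemma interface_mu s j : interface (problem s) (mu_read j).
Proof. by right; exists j. Qed.

Lemma interface_rho s n : interface (problem s) (@rho_read R G J r Diag n).
Proof. by left; exists n. Qed.

Lemma margin_read (x y : input) i n : mu_read i x = mu_read i y ->
  rho_read r n x = rho_read r n y -> margin x i n = margin y i n.
Proof. by rewrite /margin /mu_read /rho_read => -> ->. Qed.

(** The algorithm with indices [m] (outer) and [k] (inner) tests the margins with
    indices below [k] against the threshold plus [2 ^- m]. The answer is
    nonincreasing in [k], and its limit is nondecreasing in [m]. *)
Lemma diag_has_tower2 s : has_tower (problem s) 2.
Proof.
pose F k : set (input -> R[i]) :=
  [set mu_read i | i in `I_k] `|` [set @rho_read R G J r Diag n | n in `I_k].
pose f (m k : nat) (x : input) : bool :=
  [forall i : 'I_k, forall n : 'I_k, threshold s + 2 ^- m <= margin x i n].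
have fP m k x : reflect (forall i n, (i < k)%N -> (n < k)%N ->
    threshold s + 2 ^- m <= margin x i n) (f m k x).
  apply: (iffP forallP) => [h i n ik nk|h i].
    by have /forallP/(_ (Ordinal nk)) := h (Ordinal ik).
  by apply/forallP => n; exact: h.
have FP k : F k `<=` interface (problem s).
  by move=> _ [[i _ <-]|[i _ <-]]; [exact: interface_mu|exact: interface_rho].
have finF k : finite_set (F k).
  by rewrite finite_setU; split; exact/finite_image/finite_II.
have fF m k x y : (forall l, F k l -> l y = l x) -> f m k y = f m k x.
  move=> yx; have mE i n : (i < k)%N -> (n < k)%N -> margin y i n = margin x i n.
    by move=> ik nk; apply: margin_read; apply: yx; [left; exists i|right; exists n].
  by apply/idP/idP => /fP h; apply/fP => i n ik nk; [rewrite -mE|rewrite mE] => //; exact: h.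
exists (fun t => @fixed_read_algorithm R (problem s) (F (nth 0%N t 1))
  (f (nth 0%N t 0) (nth 0%N t 1)) (FP _) (finF _) (fF _ _)) => x /=.
exists (fun m => `[< forall i n, threshold s + 2 ^- m <= margin x i n >] : decision R).
  move=> m; exists (fun k => f m k x) => //.
  apply/decision_cvgP.
  have [h|/existsNP[i /existsNP[n hin]]] :=
    pselect (forall i n, threshold s + 2 ^- m <= margin x i n).
    by exists 0%N => k _; rewrite asboolT//; apply/fP => i n _ _; exact: h.
  exists (maxn i n).+1 => k; rewrite gtn_max => /andP[ik nk].
  rewrite asboolF; first by apply/negbTE/fP => /(_ i n ik nk).
  by move=> /(_ i n).
apply/decision_cvgP; case E : (problem_target _ _ _).
  have [d d0 hd] := (problem_target_margin s x).1 E.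
  have [N _ hN] := near_infty_natSinv_expn_lt (PosNum d0).
  exists N => m /hN /=; rewrite div1r => /ltW md; apply/asboolP => i n.
  by apply: le_trans (hd i n); rewrite lerD2l.
exists 0%N => m _; apply/asboolP => h.
suff : problem_target eps s x = true by rewrite E.
apply/problem_target_margin; by exists (2 ^- m).
Qed.

Lemma finite_reads_bound s (F : set (input -> R[i])) :
  finite_set F -> F `<=` interface (problem s) ->
  exists N, forall x y : input, x.2 = y.2 ->
    (forall j, (j < N)%N -> x.1 j = y.1 j) -> forall g, F g -> g x = g y.
Proof.
move=> finF FP.
have /choice[N hN] : forall g : input -> R[i], exists N, F g ->
    forall x y : input, x.2 = y.2 -> (forall j, (j < N)%N -> x.1 j = y.1 j) ->
    g x = g y.
  move=> g; have [/FP|nFg] := pselect (F g); last by exists 0%N.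
  case=> [[n _ <-]|[j _ <-]]; first by exists 0%N => _ x y; rewrite /rho_read => ->.
  by exists j.+1 => _ x y _; apply.
have /finite_seqP[t tE] := finite_image N finF.
exists (\max_(i <- t) i)%N => x y xy2 xy1 g Fg; apply: hN => // j jN.
apply: xy1; apply: leq_trans jN _.
have : N g \in t by have : [set` t] (N g) by rewrite -tE; exists g.
elim: (t) => // i u IH; rewrite inE big_cons leq_max => /orP[/eqP ->|/IH ->].
  by rewrite leqnn.
by rewrite orbT.
Qed.

Variables (z : R) (Jz : J z).

(** A diagonal that lies at the prescribed distances to the right of [z]. *)
Definition offset_input (t : nat -> R) : input :=
  (fun j => (z + t j)%:C, window_pt z Jz).

Lemma offset_target s (t : nat -> R) : (forall j, 0 <= t j) ->
  problem_target eps s (offset_input t) = true <->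
  exists2 d, 0 < d & forall j, threshold s + d <= t j.
Proof.
move=> t0; rewrite (problem_target_diag s _ z%:C)//.
have nE j : normc ((offset_input t).1 j - z%:C) = t j.
  by rewrite -rmorphB /= addrAC subrr add0r -[RHS](normc_real (t j)).
by split=> -[d d0 hd]; exists d => // j; have := hd j; rewrite nE.
Qed.

(** The adversary argument: [next] extends a prefix [u] by a block of value [c k]
    long enough for some algorithm of index at least [k] to answer 1 on every
    continuation, and [S k] are the prefixes obtained by iterating it. *)
Lemma diag_no_tower1 s : ~ has_tower (problem s) 1.
Proof.
move=> [Gam hG]; pose alg n := Gam [tuple n].
have lim (x : input) : exists N, forall n, (N <= n)%N -> alg n x = problem_target eps s x.
  have [v vE] := hG x; move=> /decision_cvgP[N hN]; exists N => n Nn.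
  exact: etrans (vE n) (hN n Nn).
pose c k : R := threshold s + k.+1%:R^-1.
have cgt k : threshold s < c k by rewrite ltrDl invr_gt0.
pose extends (u : seq R) (t : nat -> R) := forall i, (i < size u)%N -> t i = nth 0 u i.
pose good u := forall i, (i < size u)%N -> threshold s < nth 0 u i.
have /choice[next nextP] : forall ku : nat * seq R, exists mn : nat * nat, good ku.2 ->
    (ku.1 <= mn.2)%N /\ forall t, extends (ku.2 ++ nseq mn.1.+1 (c ku.1)) t ->
      alg mn.2 (offset_input t) = true.
  move=> [k u] /=; have [gu|] := pselect (good u); last by exists (0, 0)%N.
  (* The prefix [u] continued by [c k] forever stays away from the threshold, so
     the algorithms eventually answer 1 on it. *)
  pose t0 i := nth (c k) u i.
  have t0P : exists2 d, 0 < d & forall j, threshold s + d <= t0 j.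
    have [d d0 hd] : exists2 d, 0 < d & forall x, x \in c k :: u -> threshold s + d <= x.
      have {}gu : all (> threshold s) (c k :: u).
        by rewrite /= cgt; apply/(all_nthP 0) => i /gu.
      elim: (c k :: u) gu => [|x v IH] /=; first by exists 1.
      move=> /andP[sx /IH[d d0 hd]]; exists (Num.min d (x - threshold s)).
        by rewrite lt_min d0 subr_gt0.
      move=> y; rewrite inE => /orP[/eqP ->|/hd].
        by rewrite -lerBrDl ge_min lexx orbT.
      by apply: le_trans; rewrite lerD2l ge_min lexx.
    exists d => // j; apply: hd; rewrite /t0 inE.
    have [ju|ju] := ltnP j (size u); first by rewrite mem_nth ?orbT.
    by rewrite nth_default// eqxx.
  have t00 j : 0 <= t0 j.
    by have [d d0 /(_ j)] := t0P; have := threshold_ge0 eps eps_gt0 s; lra.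
  have [N hN] := lim (offset_input t0).
  pose n := maxn N k; have nT := hN n (leq_maxl _ _).
  rewrite (offset_target s t0 t00).2// in nT.
  have [M hM] := finite_reads_bound s _ (@alg_read_finite _ _ (alg n) (offset_input t0))
    (@alg_read_sub _ _ (alg n) (offset_input t0)).
  exists (M, n) => _; split=> [|t ut]; first exact: leq_maxr.
  rewrite -nT; apply: (proj1 (@alg_consistent _ _ (alg n) (offset_input t0) _ _)) => g; apply: hM => //= j jM.
  have ju : (j < size (u ++ nseq M.+1 (c k)))%N.
    by rewrite size_cat size_nseq (leq_trans jM)// addnS leqW// leq_addl.
  rewrite ut//.
  rewrite nth_cat /t0; case: ltnP => uj; first by rewrite (set_nth_default 0).
  by rewrite (nth_default (c k))// -[c k :: _]/(nseq M.+1 (c k)) nth_nseq ltnS (leq_trans (leq_subr _ _) (ltnW jM)).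
pose S := fix S k := if k is k'.+1
  then S k' ++ nseq (next (k', S k')).1.+1 (c k') else [::].
have SS k : S k.+1 = S k ++ nseq (next (k, S k)).1.+1 (c k) by [].
have Sgood k : good (S k).
  elim: k => [//|k IH] i; rewrite SS size_cat nth_cat size_nseq.
  case: (ltnP i (size (S k))) => [iS _|Si]; first exact: IH.
  by rewrite nth_nseq -ltn_subLR// => ->; exact: cgt.
have Ssize k : (k <= size (S k))%N.
  by elim: k => [//|k IH]; rewrite SS size_cat size_nseq addnS ltnS (leq_trans IH)// leq_addr.
have Spre k l i : (k <= l)%N -> (i < size (S k))%N ->
    (i < size (S l))%N /\ nth 0 (S l) i = nth 0 (S k) i.
  move=> kl ik; elim: l kl => [|l IH]; first by rewrite leqn0 => /eqP <-.
  rewrite leq_eqVlt => /orP[/eqP <- //|]; rewrite ltnS => /IH[il <-].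
  by rewrite SS size_cat nth_cat il (leq_trans il)// leq_addr.
pose t i := nth 0 (S i.+1) i.
have St k : extends (S k) t.
  move=> i ik; rewrite /t; have [ki|ki] := leqP k i.+1.
    by case: (Spre k i.+1 i).
  by case: (Spre i.+1 k i) => //; exact: ltnW.
have tgt i : threshold s < t i by apply: Sgood; exact: Ssize.
have tT : problem_target eps s (offset_input t) = true.
  have [N hN] := lim (offset_input t).
  have [/= Nn nT] := nextP (N, S N) (Sgood N).
  by rewrite -(hN _ Nn); apply: nT; rewrite -SS; exact: St.
have /(offset_target s t) : problem_target eps s (offset_input t) = true by [].
case=> [j|d d0 hd].
  by apply: le_trans (ltW (tgt j)); exact: threshold_ge0.
have [k _ /(_ k (leqnn k)) /= kd] := near_infty_natSinv_lt (PosNum d0).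
have := hd (size (S k)); rewrite (St k.+1).
  by rewrite SS nth_cat ltnn subnn /= lerD2l leNgt kd.
by rewrite SS size_cat size_nseq addnS ltnS leq_addr.
Qed.

Lemma diag_SCI s : SCI_G (problem s) = Some 2%N.
Proof. exact: SCI_G_eq2 (diag_has_tower2 s) (diag_no_tower1 s). Qed.

End DiagonalHeight.

(** * Diagonal operators as general operators and as graph operators *)

Section DiagonalCore.
Context {R : realType} {I : choiceType}.
Local Notation H := (l2_hilbert R I).
Local Notation coord x i := ((x : l2 R I) i).

Lemma coord_sum_basis (F : seq I) (c : I -> R[i]) j : uniq F ->
  coord (\sum_(i <- F) c i *: (l2_basis i : H)) j = if j \in F then c j else 0.
Proof.
elim: F => [|i F IH] /=; first by rewrite big_nil.
move=> /andP[iF uF]; rewrite big_cons l2_linE IH// inE /=.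
case: eqVneq => [->|_]; first by rewrite (negPf iF) mulr1 addr0.
by rewrite mulr0 add0r.
Qed.

Lemma truncate_span (x : H) (F : {fset I}) : lin_span l2_basis (l2_truncate x F).
Proof.
exists F, (fun i => coord x i); apply: l2_ext => j.
by rewrite coord_sum_basis.
Qed.

Lemma span_diag_dom (a : I -> R[i]) : lin_span l2_basis `<=` dom (diag_op a).
Proof.
move=> _ [F [c ->]].
by case: (@lin_span_sum R I (diag_op a) F c (diag_dom_basis a)).
Qed.

Lemma hcvg_harmonic (u : nat -> H) (x : H) :
  (forall n, hnorm (u n - x) <= n.+1%:R^-1) -> hcvg u x.
Proof.
move=> ux; apply: (@squeeze_cvgr _ _ _ _ (fun=> 0) (@harmonic R)).
- by apply: nearW => n; rewrite hnorm_ge0 ux.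
- exact: cvg_cst.
- exact: cvg_harmonic.
Qed.

(** Truncations of [x] must converge together with their images. Both errors are
    dominated coordinatewise by the truncation error of the single l2 vector [w],
    so one family of finite sets serves both. *)
Lemma diag_core (a : I -> R[i]) : core (diag_op a) (lin_span l2_basis).
Proof.
split=> [|x dx]; first exact: span_diag_dom.
pose w i := (normc (coord x i))%:C + (normc (a i * coord x i))%:C.
have wE i : normc (w i) = normc (coord x i) + normc (a i * coord x i).
  by rewrite /w -rmorphD normc_real ?addr_ge0 ?normc_ge0.
have sw : square_summable w.
  have abs (f : I -> R[i]) : square_summable f -> square_summable (fun i => (normc (f i))%:C).
    by apply: esumr_lt => i; rewrite normc_real ?normc_ge0.
  by apply: square_summableD; apply: abs => //; exact: l2P.
have lw : w \in @l2_pred R I by exact/asboolP.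
pose y : H := L2 lw.
have /choice[F hF] n : exists F : {fset I}, hnorm (y - l2_truncate y F) < n.+1%:R^-1.
  by apply: l2_truncate_approx; rewrite invr_gt0.
pose u n := l2_truncate x (F n).
have du n : diag_dom a (u n) by apply: span_diag_dom; exact: truncate_span.
exists u; split=> [n||].
- exact: truncate_span.
- apply: hcvg_harmonic => n; apply: le_trans (ltW (hF n)).
  rewrite -[leRHS]mul1r; apply: le_hnorm => // i; rewrite mul1r !l2_subE /=.
  case: ifP => _; first by rewrite subrr normc0 normc_ge0.
  by rewrite sub0r subr0 normcN wE lerDl normc_ge0.
- apply: hcvg_harmonic => n; apply: le_trans (ltW (hF n)).
  rewrite -[leRHS]mul1r; apply: le_hnorm => // i.
  rewrite mul1r !l2_subE [coord (diag_op a (u n)) i]diag_appE//.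
  rewrite [coord (diag_op a x) i]diag_appE//=.
  case: ifP => _; first by rewrite subrr normc0 normc_ge0.
  by rewrite mulr0 sub0r subr0 normcN wE lerDr normc_ge0.
Qed.

(** Testing the adjoint relation on basis vectors determines the coordinates of
    the adjoint vector. *)
Lemma adjoint_diag (a : I -> R[i]) :
  adjoint (diag_cdop a) = diag_op (fun i => conjc (a i)).
Proof.
have relE y z : adjoint_rel (diag_cdop a) y z ->
    forall j, coord z j = conjc (a j) * coord y j.
  move=> h j; have := h _ (diag_dom_basis a j).
  rewrite [_ (l2_basis j)]diag_basis hdotZl hdotC hdot_basis.
  rewrite [hdot _ z]hdotC hdot_basis => /(congr1 conjc).
  by rewrite rmorphM /= !conjcK => ->.
have drel y : dom (diag_op (fun i => conjc (a i))) y ->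
    adjoint_rel (diag_cdop a) y (diag_op (fun i => conjc (a i)) y).
  move=> dy x dx; rewrite /= /l2_dot; congr csum; apply/funext => i.
  rewrite !diag_appE// rmorphM /= conjcK; ring.
have domE : dom (adjoint (diag_cdop a)) = dom (diag_op (fun i => conjc (a i))).
  apply/seteqP; split=> y; last by move=> /drel h; exists (diag_op (fun i => conjc (a i)) y).
  move=> [z /relE zE]; rewrite /= /diag_dom /=.
  have -> : (fun j => conjc (a j) * coord y j) = (z : l2 R I) :> (I -> R[i]).
    by apply/funext => j; rewrite zE.
  exact: l2P.
apply: operator_ext => // y; rewrite domE => /drel; exact: adjoint_appP.
Qed.

Lemma diag_core_adjoint (a : I -> R[i]) :
  core (adjoint (diag_cdop a)) (lin_span l2_basis).
Proof. by rewrite adjoint_diag; exact: diag_core. Qed.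

End DiagonalCore.

Section DiagonalInclusions.
Context {R : realType}.
Local Notation N2 := (l2_hilbert R nat).

Lemma coord_proj_n n (x : N2) j :
  (proj_n n x : l2 R nat) j = if (j < n.+1)%N then (x : l2 R nat) j else 0.
Proof. by rewrite coord_sum_basis ?iota_uniq// mem_index_iota hdot_basis. Qed.

(** A diagonal operator maps the span of the first basis vectors into itself. *)
Lemma diag_off_range (b : nat -> R[i]) n x : off_range (diag_op b) n n x = 0.
Proof.
apply/eqP; rewrite subr_eq0; apply/eqP/l2_ext => j.
have dP : diag_dom b (proj_n n x).
  have [d _] := @lin_span_sum R nat (diag_op b) (index_iota 0 n.+1)
    (fun i => hdot x (l2_basis i)) (diag_dom_basis b).
  exact: d.
rewrite [RHS]coord_proj_n [LHS]diag_appE//.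
case: ifP => jn; first by rewrite [RHS]diag_appE.
by rewrite coord_proj_n jn mulr0.
Qed.

Lemma opnorm_off_range_diag (b : nat -> R[i]) n :
  (opnorm (off_range (diag_op b) n n) <= 0)%E.
Proof. by apply: ge_ereal_sup => _ [x _ <-]; rewrite diag_off_range hnorm0. Qed.

Lemma exp2_cvg0 : (ratr (2 ^- n.+1 : rat) : R) @[n --> \oo] --> (0 : R).
Proof.
apply/cvgr0Pnorm_lt => e e0.
have [N _ hN] := near_infty_natSinv_expn_lt (PosNum e0).
exists N => // n /hN /=; rewrite div1r => h.
rewrite fmorphV rmorphXn /= ratr_nat ger0_norm//.
apply: le_lt_trans h; rewrite lef_pV2 ?posrE ?exprn_gt0//.
by rewrite ler_eXn2l// ltr1n.
Qed.

(** Transparent, since the readings of the dispersion data have to compute to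
    constants. *)
Definition diag_gen (a : nat -> R[i]) : gen_instance R.
Proof.
apply: (@GenInstance R (diag_cdop a) (diag_core a) (diag_core_adjoint a) id
  (fun n => 2 ^- n.+1) _ exp2_cvg0) => n //.
rewrite adjoint_diag ge_max; apply/andP; split;
  by apply: le_trans (opnorm_off_range_diag _ _) _; rewrite lee_fin ler0q.
Defined.

Lemma diag_to_gen_diag_gen (G : graph) : @diag_to_gen R G diag_gen.
Proof.
move=> a; split=> //; split=> //.
by apply/seteqP; split=> [x dx|_ [x dx <-]//]; exists x.
Qed.

Variable G : graph.
Variable nu : vertex G -> nat.
Hypothesis venumK : cancel (venum G) nu.
Hypothesis nuK : cancel nu (venum G).
Local Notation V2 := (l2_hilbert R (vertex G)).

Lemma esumr_reindex (p : nat -> R) : esumr (p \o nu) = esumr p.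
Proof.
symmetry; apply: reindex_esum; split=> //.
- by move=> v w _ _ /(can_inj nuK).
- by move=> n _; exists (venum G n).
Qed.

Lemma rsum_reindex (f : nat -> R) : rsum (f \o nu) = rsum f.
Proof. by rewrite /rsum -!esumr_reindex. Qed.

Lemma csum_reindex (f : nat -> R[i]) : csum (f \o nu) = csum f.
Proof. by rewrite /csum -!rsum_reindex. Qed.

Lemma relabel_subproof (x : N2) :
  ((x : l2 R nat) : nat -> R[i]) \o nu \in @l2_pred R (vertex G).
Proof.
apply/asboolP; rewrite /square_summable.
by rewrite (esumr_reindex (fun i => normc ((x : l2 R nat) i) ^+ 2)); exact: l2P.
Qed.

(** Transport along the enumeration of the vertices: coordinate [v] is read at
    the index of [v]. *)
Definition relabel (x : N2) : V2 := L2 (relabel_subproof x).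

Lemma relabel_surj (y : V2) : exists x, relabel x = y.
Proof.
have ly : ((y : l2 R (vertex G)) : vertex G -> R[i]) \o venum G \in @l2_pred R nat.
  apply/asboolP; rewrite /square_summable -esumr_reindex.
  rewrite (eq_esumr (q := fun v => normc ((y : l2 R (vertex G)) v) ^+ 2)); first exact: l2P.
  by move=> v; rewrite /= nuK.
by exists (L2 ly : N2); apply: l2_ext => v /=; rewrite nuK.
Qed.

Lemma relabel_unitary : unitary relabel.
Proof.
split; last exact: relabel_surj; first by move=> c x y; exact: l2_ext.
move=> x y.
exact: (csum_reindex (fun i => (x : l2 R nat) i * conjc ((y : l2 R nat) i))).
Qed.

Lemma relabel_basis n : relabel (l2_basis n) = l2_basis (venum G n).
Proof. by apply: l2_ext => v /=; rewrite -(can_eq venumK) nuK. Qed.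

Lemma relabel_conj (a : nat -> R[i]) :
  conjugate_by relabel (diag_op a) (diag_op (a \o nu)).
Proof.
have domE x : dom (diag_op (a \o nu)) (relabel x) = dom (diag_op a) x.
  rewrite /= /diag_dom /= /square_summable.
  by rewrite -(esumr_reindex (fun i => normc (a i * (x : l2 R nat) i) ^+ 2)).
split=> [|x dx].
  apply/seteqP; split=> [y|_ [x dx <-]]; last by rewrite domE.
  by have [x <-] := relabel_surj y; rewrite domE => dx; exists x.
have dWx : dom (diag_op (a \o nu)) (relabel x) by rewrite domE.
apply: l2_ext => v; rewrite [LHS]diag_appE//=.
by rewrite diag_appE.
Qed.

Definition diag_graph (a : nat -> R[i]) : graph_instance R G.
Proof.
apply: (@GraphInstance R G (diag_cdop (a \o nu)) (diag_core _)
  (diag_core_adjoint _) (fun v => [fset v]%fset)) => v w.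
rewrite inE /graph_entry => wv.
have E x y : x != y -> hdot (diag_op (a \o nu) (l2_basis y)) (l2_basis x) = 0.
  by move=> xy; rewrite diag_basis hdotZl hdot_basis /= (negPf xy) mulr0.
by split; apply: E; rewrite // eq_sym.
Defined.

Lemma diag_to_graph_diag_graph : @diag_to_graph R G diag_graph.
Proof.
exists relabel; split=> //; first exact: relabel_unitary.
- exact: relabel_basis.
- exact: relabel_conj.
Qed.

End DiagonalInclusions.

(** * Geometric encodings and the two preorders *)

Lemma eqb_iff (b c : bool) : (b = true <-> c = true) -> b = c.
Proof. by case: b; case: c => -[h1 h2] //; [rewrite h1|rewrite h2]. Qed.

Section DirectSumSpectrum.
Context {R : realType} {H1 H2 : hilbertSpace R}.

Lemma spectral_of_opsum (eps : R) s (A : operator H1) (B : operator H2) : 0 < eps ->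
  spectral_of eps s (opsum A B) = spectral_of eps s A `|` spectral_of eps s B.
Proof.
move=> e0; have i0 : 0 <= eps^-1 by rewrite invr_ge0 ltW.
case: s => /=; last first.
  rewrite !pseudospectrumE//.
  pose unbounded (H : hilbertSpace R) (C : operator H) : set R[i]^o :=
    ~` [set z | resolvent_bound C z eps^-1].
  transitivity (closure (unbounded _ A `|` unbounded _ B)).
    2: exact: (closureU (unbounded _ A) (unbounded _ B)).
  apply: congr1; apply/seteqP; split=> z /=.
    by rewrite resolvent_bound_sum// => /not_andP.
  by rewrite resolvent_bound_sum// => -[nA [hA _]|nB [_ hB]]; [exact: nA|exact: nB].
apply/seteqP; split=> z /=.
  move=> sz; apply: contrapT => /not_orP[]; rewrite !spectrumP.
  move=> /contrapT[M M0 hA] /contrapT[M' M0' hB]; move/spectrumP: sz; apply.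
  have wk (H : hilbertSpace R) (C : operator H) N N' : N <= N' ->
      resolvent_bound C z N -> resolvent_bound C z N'.
    move=> NN' [srj bnd]; split=> // x dx; apply: le_trans (bnd x dx) _.
    by rewrite ler_wpM2r ?hnorm_ge0.
  (* A common bound for both resolvents. *)
  exists (Num.max M M'); first by rewrite le_max M0.
  apply/resolvent_bound_sum; first by rewrite le_max M0.
  by split; [apply: wk hA|apply: wk hB]; rewrite le_max lexx ?orbT.
rewrite !spectrumP => -[] h [M M0 /(resolvent_bound_sum _ _ _ _ M0)[hA hB]];
  by apply: h; exists M.
Qed.

End DirectSumSpectrum.

Section Encodings.
Context {R : realType} {G : graph} {J : set R} {eps : R}.
Variables (r : window_approx J) (code : fset_code (vertex G)).
Variable Enc : forall rho rho', set (input G J rho -> input G J rho').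
Hypothesis eps_gt0 : 0 < eps.
Local Notation problem := (ambient_problem eps r code).
Local Notation le_raw := (le_raw eps r code).
Local Notation le_geom := (le_geom eps r code Enc).
Local Notation target s x := (@problem_target R G J eps s _ x).

Lemma conjugate_spectral s (H1 H2 : hilbertSpace R) (U : H1 -> H2)
    (A : operator H1) (B : operator H2) :
  unitary U -> conjugate_by U A B -> spectral_of eps s A = spectral_of eps s B.
Proof.
move=> uU cU; apply: eq_spectral_of => // z M _.
exact: resolvent_bound_conj uU cU.
Qed.

(** The first four forms are unitary conjugations. The fifth adds the spectral
    set of [T0], which by hypothesis has no point in [J]. *)
Lemma elementary_form_spectral rho rho' (T : Omega R G rho -> Omega R G rho') :
  elementary_form J eps T -> forall s a t, J t ->
  spectral_of eps s (op_of (T a)) t%:C <-> spectral_of eps s (op_of a) t%:C.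
Proof.
case=> {rho rho' T}.
- by move=> rho rho' T U uU cU s a t _; rewrite (conjugate_spectral s _ _ U _ _ uU (cU a)).
- by move=> rho rho' T U ? _ _ _ uU _ cU s a t _; rewrite (conjugate_spectral s _ _ U _ _ uU (cU a)).
- by move=> T U ? _ _ uU _ cU s a t _; rewrite (conjugate_spectral s _ _ U _ _ uU (cU a)).
- by move=> rho rho' T U uU cU s a t _; rewrite (conjugate_spectral s _ _ U _ _ uU (cU a)).
move=> rho rho' T H0 T0 W uW spT0 psT0 cW s a t Jt.
rewrite -(conjugate_spectral s _ _ W _ _ uW (cW a)) spectral_of_opsum//.
have nT0 : ~ spectral_of eps s T0 t%:C.
  have Jc : real_points J t%:C by exists t.
  move=> h; suff : set0 (t%:C : R[i]) by [].
  by case: s h => h; [rewrite -spT0|rewrite -psT0].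
by split=> [[//|/nT0]|]; [|left].
Qed.

Lemma encode_target rho rho' (T : Omega R G rho -> Omega R G rho') :
  elementary_form J eps T -> forall s x, target s (encode T x) = target s x.
Proof.
move=> eT s [a [K [t Jt KE]]]; rewrite /problem_target /encode /= KE.
have e := elementary_form_spectral _ _ _ eT s a t Jt.
apply: asbool_equiv_eq; split=> h; apply/seteqP; split=> // w [sw wt];
  rewrite -h; split=> //; move: sw; rewrite [w]wt; by move/e.
Qed.

Hypothesis Enc_structure : geometric_structure eps Enc.

Lemma geometric_encoding_target rho rho' (e : input G J rho -> input G J rho') :
  geometric_encoding Enc e -> forall s x, target s (e x) = target s x.
Proof.
have [EncE _ _] := Enc_structure.
elim=> {rho rho' e} [//|rho rho' rho'' e e' _ IH /EncE[T eT ->] s x].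
by rewrite /= encode_target.
Qed.

Lemma geometric_encoding_comp rho rho' rho'' (e : input G J rho -> input G J rho')
    (e' : input G J rho' -> input G J rho'') :
  geometric_encoding Enc e -> geometric_encoding Enc e' ->
  geometric_encoding Enc (e' \o e).
Proof.
move=> ge ge'; elim: ge' e ge => {rho' rho'' e'} [//|rho1 rho2 rho3 e1 e2 _ IH E2 e ge].
exact: (@geometric_comp _ _ _ _ _ _ _ (e1 \o e) e2 (IH _ ge) E2).
Qed.

Lemma le_geom_refl p : le_geom p p.
Proof.
exists id; first exact: geometric_id.
exact: (reduces_via_id (problem p)).
Qed.

Lemma le_geom_trans p q t : le_geom p q -> le_geom q t -> le_geom p t.
Proof.
move=> [e ge re] [e' ge' re']; exists (e' \o e).
  exact: geometric_encoding_comp ge ge'.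
exact: reduces_via_comp re re'.
Qed.

Lemma le_raw_refl p : le_raw p p.
Proof. exists id; exact: reduces_via_id. Qed.

Lemma le_raw_trans p q t : le_raw p q -> le_raw q t -> le_raw p t.
Proof.
by move=> [e re] [e' re']; exists (e' \o e); exact: reduces_via_comp re re'.
Qed.

Lemma le_geom_raw p q : le_geom p q -> le_raw p q.
Proof. by move=> [e _ re]; exists e. Qed.

Lemma geometric_encoding1 rho rho' (e : input G J rho -> input G J rho') :
  Enc _ _ e -> geometric_encoding Enc e.
Proof. exact: (@geometric_comp _ _ _ _ _ _ _ id e (geometric_id _ _)). Qed.

(** An encoding preserves the targets on its own, so only the readability of its
    outputs has to be checked. *)
Lemma le_geom_of_encoding s rho rho' (e : input G J rho -> input G J rho') :
  Enc _ _ e ->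
  (forall l, rep_interface r code l ->
     @finitely_read R (problem (s, rho)) (l \o e)) ->
  le_geom (s, rho) (s, rho').
Proof.
move=> Ee hl; have ge := geometric_encoding1 _ _ _ Ee.
exists e => //; apply: (@reduces_via_intro R (problem (s, rho)) (problem (s, rho')) e id) => //.
- by move=> x; exact: cvg_id.
- by move=> x; exact: (geometric_encoding_target _ _ _ ge).
Qed.

Lemma le_geom_diag_gen s : le_geom (s, Diag) (s, Gen).
Proof.
have [_ hT _] := Enc_structure; have dT := @diag_to_gen_diag_gen R G.
apply: (le_geom_of_encoding s _ _ _ (hT _ dT)) => l [[n _ <-]|].
  by apply: (@finitely_read1 R (problem (s, Diag)) _ (@rho_read R G J r Diag n)) => //; exact: interface_rho.
case=> [[[[i j] _ <-]|[n _ <-]]|[n _ <-]]; last 2 first.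
- exact: (finitely_read_cst (problem (s, Diag)) (n.+1%:R)).
- exact: (finitely_read_cst (problem (s, Diag)) (ratr (2 ^- n.+1))).
apply: (@finitely_read1 R (problem (s, Diag)) _ (@mu_read R G J j)); first exact: interface_mu.
move=> x y; rewrite /mu_read => xy.
have entryE (u : input G J Diag) : hdot (diag_op u.1 (l2_basis j)) (l2_basis i) =
    hdot (u.1 j *: l2_basis j) (l2_basis i) by rewrite -diag_basis.
by rewrite [LHS]entryE [RHS]entryE xy.
Qed.

Lemma le_geom_diag_graph s : le_geom (s, Diag) (s, Graphical).
Proof.
have [_ _ hT] := Enc_structure.
have [nu venumK nuK] := venum_bij G.
have dT := @diag_to_graph_diag_graph R G nu venumK nuK.
apply: (le_geom_of_encoding s _ _ _ (hT _ dT)) => l [[n _ <-]|].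
  by apply: (@finitely_read1 R (problem (s, Diag)) _ (@rho_read R G J r Diag n)) => //; exact: interface_rho.
case=> [[[i j] _ <-]|[n _ <-]]; last first.
  exact: (finitely_read_cst (problem (s, Diag)) (code [fset venum G n]%fset)%:R).
apply: (@finitely_read1 R (problem (s, Diag)) _ (@mu_read R G J j)); first exact: interface_mu.
move=> x y; rewrite /mu_read => xy.
have entryE (u : input G J Diag) :
    graph_entry (diag_op (u.1 \o nu)) (venum G i) (venum G j) =
    hdot (u.1 j *: l2_basis (venum G j)) (l2_basis (venum G i)).
  by rewrite /graph_entry diag_basis /= venumK.
by rewrite [LHS]entryE [RHS]entryE xy.
Qed.

Lemma le_geom_diag s rho : le_geom (s, Diag) (s, rho).
Proof.
by case: rho; [exact: le_geom_refl|exact: le_geom_diag_gen|exact: le_geom_diag_graph].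
Qed.

Variables (z : R) (Jz : J z).

(** The window is sent to the fixed point [z], whose approximations are then
    constants; the new distances are the margins of the input, moved by the
    difference of the thresholds and cut off at 0. The pairs of indices of the
    margins are enumerated by [idx]. *)
Lemma le_raw_diag s s' : le_raw (s, Diag) (s', Diag).
Proof.
pose idx k : nat * nat := odflt (0, 0)%N (choice.unpickle k).
pose t (x : input G J Diag) k : R := Num.max 0 (threshold eps s' + margin r x (idx k).1 (idx k).2 - threshold eps s).
exists (fun x => offset_input z Jz (t x)).
apply: (@reduces_via_intro R (problem (s, Diag)) (problem (s', Diag)) _ id).
- by move=> x; exact: cvg_id.
- move=> x; apply: eqb_iff.
  rewrite (offset_target eps_gt0 z Jz s' (t x)); last by move=> k; rewrite le_max lexx.
  rewrite (problem_target_margin r eps_gt0 s x).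
  have th0 := threshold_ge0 eps eps_gt0 s'.
  split=> -[d d0 hd]; exists d => //.
    move=> i n; have := hd (choice.pickle (i, n)); rewrite /t /idx choice.pickleK /= le_max.
    by move=> /orP[|]; lra.
  by move=> k; rewrite le_max; apply/orP; right; have := hd (idx k).1 (idx k).2; lra.
- move=> l [[n _ <-]|[k _ <-]].
    exact: (finitely_read_cst (problem (s, Diag)) (qcomplex R (r (window_pt z Jz) n))).
  apply: (@finitely_read2 R (problem (s, Diag)) _ (@mu_read R G J (idx k).1) (@rho_read R G J r Diag (idx k).2)).
  + exact: interface_mu.
  + exact: interface_rho.
  + by move=> x y h1 h2; rewrite /= /t (margin_read r x y _ _ h1 h2).
Qed.

Lemma const_target s (c : R) : 0 <= c ->
  target s (offset_input z Jz (fun=> c)) = (threshold eps s < c) :> bool.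
Proof.
move=> c0; apply: eqb_iff; rewrite (offset_target eps_gt0 z Jz s (fun=> c))//.
split=> [[d d0 /(_ 0%N)]|h]; first by lra.
by exists (c - threshold eps s) => [|_]; lra.
Qed.

(** The decoder [D] would compute the [s]-target from the [s']-target on the same
    diagonal. At the distances 0 and [eps / 2] only the spectral targets differ, at
    [eps / 2] and [2 eps] only the pseudospectral ones. *)
Lemma le_geom_diag_antichain s s' : le_geom (s, Diag) (s', Diag) -> s = s'.
Proof.
move=> [e ge [[D _ DE] _]].
have [f E] : exists f : bool -> bool,
    forall c, 0 <= c -> f (threshold eps s' < c) = (threshold eps s < c).
  exists D => c c0; rewrite -!const_target//.
  by rewrite -(geometric_encoding_target _ _ _ ge); exact: DE.
have e2 : 0 < eps / 2 by rewrite divr_gt0.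
have e2e : eps / 2 < eps by rewrite ltr_pdivrMr// ltr_pMr// ltr1n.
have ee2 : eps < eps * 2 by rewrite ltr_pMr// ltr1n.
have E0 := E 0 (lexx _); have E1 := E (eps / 2) (ltW e2).
have E2 := E (eps * 2) (ltW (lt_trans eps_gt0 ee2)).
case: s s' E0 E1 E2 {E D DE e ge} => -[] //= E0 E1 E2.
- by move: E0 E1; rewrite !ltxx e2 !(lt_gtF eps_gt0) !(lt_gtF e2e) => ->.
- by move: E1 E2; rewrite ee2 e2 (lt_trans eps_gt0 ee2) (lt_gtF e2e) => ->.
Qed.

End Encodings.

Theorem corollary8p1 (R : realType) (J : set R) (eps : R) (G : graph)
    (r : window_approx J) (code : fset_code (vertex G))
    (Enc : forall rho rho', set (input G J rho -> input G J rho')) :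
  is_interval J -> compact J -> interior J !=set0 -> 0 < eps ->
  geometric_structure eps Enc ->
  [/\ (MinDeg2 (ambient_problem eps r code) (le_raw eps r code) #= `I_1)%card,
      (MinDeg2 (ambient_problem eps r code) (le_geom eps r code Enc) #= `I_2)%card,
      principal (ambient_problem eps r code) (le_raw eps r code) &
      ~ principal (ambient_problem eps r code) (le_geom eps r code Enc)].
Proof.
move=> _ _ [z /interior_subset Jz] eps0 hEnc.
have lvl s : level2 (ambient_problem eps r code) (s, Diag).
  exact: (diag_SCI r code eps0 z Jz s).
pose b (k : nat) : ambient := (if k is 0 then Spec else PseudoSpec, Diag).
have rawb q : level2 (ambient_problem eps r code) q ->
    exists2 k, (k < 1)%N & le_raw eps r code (b k) q.
  case: q => s rho _; exists 0%N => //.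
  apply: le_raw_trans (le_raw_diag r code eps0 z Jz Spec s) _.
  exact: le_geom_raw (le_geom_diag r code Enc eps0 hEnc s rho).
have geomb q : level2 (ambient_problem eps r code) q ->
    exists2 k, (k < 2)%N & le_geom eps r code Enc (b k) q.
  by case: q => -[] rho _; [exists 0%N|exists 1%N] => //; exact: le_geom_diag.
have rawt := le_raw_trans r code (eps := eps).
have geomt := le_geom_trans r code Enc (eps := eps).
have raw1 j k : (j < 1)%N -> (k < 1)%N -> le_raw eps r code (b j) (b k) -> j = k.
  by case: j k => [|//] [].
have geom2 j k : (j < 2)%N -> (k < 2)%N -> le_geom eps r code Enc (b j) (b k) -> j = k.
  by case: j k => [|[|//]] [|[|//]] _ _ // /(le_geom_diag_antichain r code Enc eps0 hEnc z Jz).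
have blvl n k : (k < n)%N -> level2 (ambient_problem eps r code) (b k) by move=> _; exact: lvl.
split.
- exact: (MinDeg2_card _ (le_raw_refl r code) rawt 1 b (blvl 1%N) rawb raw1).
- exact: (MinDeg2_card _ (le_geom_refl r code Enc) geomt 2 b (blvl 2%N) geomb geom2).
- exact/(principal_basis _ (le_raw_refl r code) rawt 1 b (blvl 1%N) rawb raw1).
- by move=> /(principal_basis _ (le_geom_refl r code Enc) geomt 2 b (blvl 2%N) geomb geom2).
Qed.
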